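(* For each $n\ge 1$ let $(c(i,j))_{1\le i,j\le n}$ be independent random variables, each having the exponential distribution with mean $n$, and let $$A_n=\min_\pi \frac1n\sum_{i=1}^n c(i,\pi(i)),$$ where the minimum is over all permutations $\pi$ of $\{1,\dots,n\}$. Then $$\lim_{n\to\infty} E A_n=\frac{\pi^2}{6}.$$ (On the right-hand side $\pi$ is the usual numerical constant.) *)

(* Defs.v *)
From HB Require Import structures.
From mathcomp Require Import all_boot all_order all_algebra perm.
From mathcomp Require Import all_classical all_reals all_analysis.

Set Implicit Arguments.
Unset Strict Implicit.
Unset Printing Implicit Defensive.

Import Order.TTheory GRing.Theory Num.Theory.
Import numFieldNormedType.Exports.

Local Open Scope classical_set_scope.
Local Open Scope ring_scope.

(* Mutual independence of a finite family of real random variables: the product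
   rule for every subfamily. *)
Definition mutually_independent d (T : measurableType d) (R : realType)
    (P : probability T R) (I : finType) (X : I -> {RV P >-> R}) : Prop :=
  forall (J : {set I}) (B : I -> set R),
    (forall i, i \in J -> measurable (B i)) ->
    P (\bigcap_(i in [set` J]) (X i @^-1` B i)) =
      (\prod_(i in J) P (X i @^-1` B i))%E.

(* The law of X is the exponential distribution with mean m, that is, with rate
   m^-1. The two laws are compared on measurable sets only, since a measure has
   unspecified values on the other sets. *)
Definition exponential_with_mean d (T : measurableType d) (R : realType)
    (P : probability T R) (m : R) (X : {RV P >-> R}) : Prop :=
  forall B : set R, measurable B ->
    distribution P X B = exponential_prob m^-1 B.

Definition assignment_cost (R : realType) (n : nat) (c : 'I_n -> 'I_n -> R)
    (s : 'S_n) : R :=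
  n%:R^-1 * \sum_(i < n) c i (s i).

(* The default value of the iterated minimum is the cost of the identity
   permutation, which is one of the values being compared. *)
Definition min_assignment_cost (R : realType) (n : nat)
    (c : 'I_n -> 'I_n -> R) : R :=
  \big[Order.min/assignment_cost c 1%g]_(s : 'S_n) assignment_cost c s.

(* Main.v *)
Require Import Defs.
From HB Require Import structures.
From mathcomp Require Import all_boot all_order all_algebra perm.
From mathcomp Require Import all_classical all_reals all_analysis.
From mathcomp Require Import measurable_realfun ring lra.

(** Write X(A, B) for the least cost of a matching of all the rows of A into
    the columns of B.  With costs of rate 1/n, the mean of the minimal
    assignment is exactly the sum of the 1/k^2 for 1 <= k <= n
    ([expected_assignment_cost]), so the limit is Euler's value of that series
    ([basel]).

    The exact formula is obtained by adding the rows one at a time, in the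
    spirit of Wastlund's proof.  Let A be a set of k rows and j a further row.
    Augmenting paths show that the best matching of j |: A uses all the columns
    used by the best matching of A, plus one more column b; let (i, b) be its
    edge at that column, the new edge.  There is almost surely exactly one new
    edge, so the probabilities that (i, b) is the new edge add up to 1
    ([new_edge_unique], [sum_prob_new_edge]).

    These probabilities can be computed in another way.  An exponential variable
    of rate r has a density equal to r times its tail.  Hence, for an entry e
    independent of the others, the probability of an event about the costs is r
    times the mean length of the set of those t in [0, c_e) for which the event
    occurs once the cost of e is lowered to t ([resample]).  For the event that
    (i, b) is the new edge, exchange arguments determine this set.  Put
    marginal A i = X(A) - X(A \ i), all columns being allowed.  If b is already
    used by A then the set is empty; otherwise it is, up to its endpoints, the
    interval from marginal A i to marginal (j |: A) i, which does not depend on b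
    ([lebesgue_new_edge]).  Since n - k columns are unused by A, summing over i
    and b gives ([sum_expected_increment])

      r (n - k) \sum_(i in j |: A) E (marginal (j |: A) i - marginal A i) = 1.

    By induction this equation forces the mean of X(A) to depend on the
    cardinal of A only and gives its value ([expected_costE]).  When A contains
    all the rows, the resulting double sum collapses to the sum of the inverse
    squares ([mean_cost_diag]). *)

Set Implicit Arguments.
Unset Strict Implicit.
Unset Printing Implicit Defensive.

Import Order.TTheory GRing.Theory Num.Theory.
Import numFieldNormedType.Exports.

Local Open Scope ring_scope.

(** * Matchings of rows into columns *)

Section Matchings.
Variables (K : realFieldType) (I J : finType).
Implicit Types (f g : {ffun I -> option J}) (A R W : {set I}) (B C : {set J}).
Implicit Types (c : I -> J -> K) (i j w : I) (b : J).

(** A matching is a partial map from rows to columns, total on I and with value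
    [None] outside its domain: all matchings thus live in one finite type and can
    be recombined row by row. *)
Definition is_matching A B f : bool :=
  [&& [forall i, (f i != None) == (i \in A)],
      [forall i, forall k, (f i == f k) ==> (f i != None) ==> (i == k)]
    & [forall i, forall b, (f i == Some b) ==> (b \in B)]].

Lemma is_matchingP A B f :
  reflect [/\ forall i, (f i != None) = (i \in A),
              forall i k, f i = f k -> f i != None -> i = k
            & forall i b, f i = Some b -> b \in B] (is_matching A B f).
Proof.
apply: (iffP and3P) => -[h1 h2 h3]; split.
- by move=> i; move/forallP: h1 => /(_ i) /eqP.
- move=> i k e n; move/forallP: h2 => /(_ i)/forallP/(_ k).
  by rewrite e eqxx /= -e n /= => /eqP.
- by move=> i b e; move/forallP: h3 => /(_ i)/forallP/(_ b); rewrite e eqxx.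
- by apply/forallP => i; rewrite h1.
- apply/forallP => i; apply/forallP => k.
  by apply/implyP => /eqP e; apply/implyP => n; apply/eqP/h2.
- apply/forallP => i; apply/forallP => b; apply/implyP => /eqP; exact: h3.
Qed.

Definition cost c f : K := \sum_i oapp (c i) 0 (f i).

Definition swap W f g : {ffun I -> option J} :=
  [ffun i => if i \in W then g i else f i].

Lemma cost_swap c W f g :
  cost c (swap W f g) + cost c (swap W g f) = cost c f + cost c g.
Proof.
rewrite /cost -!big_split /=; apply: eq_bigr => i _.
by rewrite !ffunE; case: ifP => // _; rewrite addrC.
Qed.

(** The rows met by the alternating path that starts at [w0] and goes from a row
    to its column under [f], then to the row matched to that column by [g].
    Reachability in the step relation replaces an explicit path. *)
Definition alt_reach f g w0 : {set I} :=
  [set w | connect (fun x y => (f x == g y) && (f x != None)) w0 w].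

Lemma alt_reach_refl f g w0 : w0 \in alt_reach f g w0.
Proof. by rewrite inE connect0. Qed.

Lemma alt_reach_step f g w0 w w' : w \in alt_reach f g w0 ->
  f w = g w' -> f w != None -> w' \in alt_reach f g w0.
Proof.
rewrite !inE => h e n; apply: connect_trans h _; apply: connect1.
by rewrite e eqxx -e.
Qed.

Lemma alt_reach_pred f g w0 w : w \in alt_reach f g w0 -> w != w0 ->
  exists v, [/\ v \in alt_reach f g w0, f v = g w & g w != None].
Proof.
rewrite inE => /connectP[p]; elim/last_ind: p => [|p v _] /=.
  by move=> _ ->; rewrite eqxx.
rewrite rcons_path last_rcons => /andP[hp /andP[/eqP e n]] -> _.
exists (last w0 p); split; [|by []|by rewrite -e].
by rewrite inE; apply/connectP; exists p.
Qed.

Section SwapMatching.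
Variables (A1 A2 : {set I}) (B1 B2 : {set J}) (f g : {ffun I -> option J}).
Variable w0 : I.
Hypotheses (mf : is_matching A1 B1 f) (mg : is_matching A2 B2 g).
Hypothesis fresh : forall k, f k = g w0 -> g w0 = None.
Let W := alt_reach f g w0.

(** Exchanging [f] and [g] on an alternating path preserves injectivity as soon
    as the path cannot be continued backwards from [w0], which is what [fresh]
    says.  The domain [A'] of the result is left open, since it depends on
    where the path ends. *)
Lemma swap_matching_fg A' B' : (forall i, i \in W -> (i \in A') = (i \in A2)) ->
  (forall i, i \notin W -> (i \in A') = (i \in A1)) ->
  (forall i b, i \in W -> g i = Some b -> b \in B') ->
  (forall i b, i \notin W -> f i = Some b -> b \in B') ->
  is_matching A' B' (swap W f g).
Proof.
move=> h1 h2 h3 h4.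
have [df jf _] := is_matchingP _ _ _ mf.
have [dg jg _] := is_matchingP _ _ _ mg.
have cross i k : i \in W -> k \notin W -> g i = f k -> g i = None.
  move=> iW kW e; have [iw0|iw0] := eqVneq i w0.
    by rewrite iw0; apply: (fresh (k := k)); rewrite -e iw0.
  have [v [vW fv gv]] := alt_reach_pred iW iw0.
  have vk : v = k by apply: jf; rewrite fv.
  by rewrite -vk vW in kW.
apply/is_matchingP; split.
- move=> i; rewrite ffunE; case: ifPn => iW; [by rewrite dg h1|by rewrite df h2].
- move=> i k; rewrite !ffunE; case: ifPn => iW; case: ifPn => kW.
  + exact: jg.
  + by move=> e; rewrite (cross i k).
  + by move=> e; rewrite e (cross k i).
  + exact: jf.
- by move=> i b; rewrite ffunE; case: ifPn => iW; [exact: h3|exact: h4].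
Qed.

(** The other half of the same exchange: here injectivity holds because the path
    is closed under going forward. *)
Lemma swap_matching_gf A' B' : (forall i, i \in W -> (i \in A') = (i \in A1)) ->
  (forall i, i \notin W -> (i \in A') = (i \in A2)) ->
  (forall i b, i \in W -> f i = Some b -> b \in B') ->
  (forall i b, i \notin W -> g i = Some b -> b \in B') ->
  is_matching A' B' (swap W g f).
Proof.
move=> h1 h2 h3 h4.
have [df jf _] := is_matchingP _ _ _ mf.
have [dg jg _] := is_matchingP _ _ _ mg.
have cross i k : i \in W -> k \notin W -> f i = g k -> f i = None.
  move=> iW kW e; apply/eqP; apply: contraNT kW => n.
  exact: alt_reach_step iW e n.
apply/is_matchingP; split.
- move=> i; rewrite ffunE; case: ifPn => iW; [by rewrite df h1|by rewrite dg h2].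
- move=> i k; rewrite !ffunE; case: ifPn => iW; case: ifPn => kW.
  + exact: jf.
  + by move=> e; rewrite (cross i k).
  + by move=> e; rewrite e (cross k i).
  + exact: jg.
- by move=> i b; rewrite ffunE; case: ifPn => iW; [exact: h3|exact: h4].
Qed.

End SwapMatching.

(** A matching that depends on [A] and [B] only, so that the default value of the
    iterated minimum below is itself a cost, linear in the matrix. *)
Definition some_matching A B : {ffun I -> option J} :=
  odflt [ffun => None] [pick f | is_matching A B f].

Definition min_cost c A B : K :=
  \big[Order.min/cost c (some_matching A B)]_(f | is_matching A B f) cost c f.

Lemma min_cost_le c A B f : is_matching A B f -> min_cost c A B <= cost c f.
Proof. by move=> mf; rewrite /min_cost; apply: bigmin_le_cond. Qed.

Lemma some_matchingP A B : (#|A| <= #|B|)%N -> is_matching A B (some_matching A B).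
Proof.
move=> AB; rewrite /some_matching; case: pickP => //= no.
have mem i : i \in A -> (index i (enum A) < #|B|)%N.
  by move=> iA; apply: leq_trans AB; rewrite cardE index_mem mem_enum.
have [A0|[i0 i0A]] := finset.set_0Vmem A.
  by apply/is_matchingP; split=> [i|i k|i b]; rewrite !ffunE ?A0 ?inE.
have /card_gt0P[b0 _] : (0 < #|B|)%N by apply: leq_ltn_trans (mem _ i0A).
pose f := [ffun i => if i \in A then Some (nth b0 (enum B) (index i (enum A)))
                     else None].
suff : is_matching A B f by rewrite no.
apply/is_matchingP; split => [i|i k|i b]; rewrite !ffunE; first by case: ifP.
  case: ifP => // iA; case: ifP => // kA [/eqP].
  rewrite nth_uniq ?enum_uniq -?cardE ?mem// => /eqP e _.
  have e1 := nth_index i (_ : i \in enum A); rewrite -e1 ?mem_enum// e.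
  by rewrite nth_index// mem_enum.
by case: ifP => // iA [<-]; rewrite -mem_enum mem_nth// -cardE mem.
Qed.

Lemma min_cost_attained c A B : (#|A| <= #|B|)%N ->
  exists2 f, is_matching A B f & min_cost c A B = cost c f.
Proof.
move=> AB; rewrite /min_cost.
elim/big_ind: _ => [|x y [f mf ->] [g mg ->]|f mf]; last by exists f.
  by exists (some_matching A B) => //; exact: some_matchingP.
by case: (leP (cost c f) (cost c g)) => _; [exists f|exists g].
Qed.

Lemma is_matching_sub A B B' f : B \subset B' ->
  is_matching A B f -> is_matching A B' f.
Proof.
move=> /fintype.subsetP BB' /is_matchingP[h1 h2 h3]; apply/is_matchingP; split=> //.
by move=> i b /h3 /BB'.
Qed.

Lemma min_cost_sub_col c A B B' : (#|A| <= #|B|)%N -> B \subset B' ->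
  min_cost c A B' <= min_cost c A B.
Proof.
move=> /(min_cost_attained c)[f mf ->] BB'; apply: min_cost_le.
exact: is_matching_sub mf.
Qed.

Definition restrict A f : {ffun I -> option J} :=
  [ffun i => if i \in A then f i else None].

Lemma is_matching_restrict A A' B f : A' \subset A ->
  is_matching A B f -> is_matching A' B (restrict A' f).
Proof.
move=> /fintype.subsetP A'A /is_matchingP[h1 h2 h3]; apply/is_matchingP.
split=> [i|i k|i b]; rewrite !ffunE.
- by case: ifP => // iA'; rewrite h1 A'A.
- by case: ifP => // iA'; case: ifP => // kA' e n; [exact: h2|rewrite e in n].
- by case: ifP => // iA'; exact: h3.
Qed.

Lemma cost_restrict_le c A f : (forall i b, 0 <= c i b) ->
  cost c (restrict A f) <= cost c f.
Proof.
move=> c0; apply: ler_sum => i _; rewrite ffunE.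
by case: ifP => // _; case: (f i) => /=.
Qed.

Lemma min_cost_sub_row c A A' B : (forall i b, 0 <= c i b) ->
  (#|A| <= #|B|)%N -> A' \subset A -> min_cost c A' B <= min_cost c A B.
Proof.
move=> c0 /(min_cost_attained c)[f mf ->] A'A.
apply: le_trans (cost_restrict_le A' f c0).
by apply: min_cost_le; exact: is_matching_restrict mf.
Qed.

Lemma is_matching_remove A B f i b : f i = Some b ->
  is_matching A B f -> is_matching (A :\ i) (B :\ b) (restrict (A :\ i) f).
Proof.
move=> fi mf; have /is_matchingP[h1 h2 _] := mf.
have /is_matchingP[k1 k2 k3] := is_matching_restrict (finset.subD1set A i) mf.
apply/is_matchingP; split=> // k b' e; rewrite !inE (k3 _ _ e) andbT.
move: e; rewrite ffunE !inE; case: ifP => // /andP[ki _] fk.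
apply: contraNneq ki => bb'; apply/eqP; apply: h2; rewrite fk ?fi ?bb'//.
Qed.

Lemma cost_remove c A B f i b : f i = Some b -> is_matching A B f ->
  cost c f = c i b + cost c (restrict (A :\ i) f).
Proof.
move=> fi /is_matchingP[h1 _ _]; rewrite /cost (bigD1 i)//= fi/=; congr (_ + _).
rewrite [RHS](bigD1 i)//= ffunE !inE eqxx/= add0r.
apply: eq_bigr => k ki; rewrite ffunE !inE ki/=; case: ifP => // /negbT.
by rewrite -h1 negbK => /eqP ->.
Qed.

Definition extend f i b : {ffun I -> option J} :=
  [ffun k => if k == i then Some b else f k].

Lemma is_matching_extend A B f i b : i \in A -> b \in B ->
  is_matching (A :\ i) (B :\ b) f -> is_matching A B (extend f i b).
Proof.
move=> iA bB /is_matchingP[h1 h2 h3].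
have nb k : f k <> Some b by move=> /h3; rewrite !inE eqxx.
apply/is_matchingP; split=> [k|k l|k b']; rewrite !ffunE.
- by case: (k =P i) => [->|/eqP ki]; rewrite ?iA// h1 !inE ki.
- case: (k =P i) => [->|_]; case: (l =P i) => [->|_]// e.
  + by have := nb l; rewrite -e.
  + by have := nb k; rewrite e.
  + exact: h2.
- by case: (k =P i) => [_ [<-]//|_ /h3]; rewrite !inE => /andP[].
Qed.

Lemma cost_extend c A B f i b : is_matching (A :\ i) B f ->
  cost c (extend f i b) = c i b + cost c f.
Proof.
move=> /is_matchingP[h1 _ _]; rewrite /cost (bigD1 i)//= ffunE eqxx/=.
congr (_ + _); rewrite [RHS](bigD1 i)//=.
have -> : f i = None by apply/eqP; rewrite -[_ == _]negbK h1 !inE eqxx.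
by rewrite add0r; apply: eq_bigr => k ki; rewrite ffunE (negPf ki).
Qed.

(** The cost of a row grows with the set of rows that compete with it.  Take the
    best matchings of j |: R and of R \ i, and exchange them along the
    alternating path from [j].  The path never meets [i], which only the first
    matching covers: every row after [j] is entered through the second one. *)
Lemma min_cost_supermodular c R i j B : i \in R -> j \notin R ->
  (#|R| < #|B|)%N ->
  min_cost c R B + min_cost c ((j |: R) :\ i) B <=
  min_cost c (j |: R) B + min_cost c (R :\ i) B.
Proof.
move=> iR jR RB.
have [f mf ->] : exists2 f, is_matching (j |: R) B f & min_cost c (j |: R) B = cost c f.
  by apply: min_cost_attained; rewrite cardsU1 jR.
have [g mg ->] : exists2 f, is_matching (R :\ i) B f & min_cost c (R :\ i) B = cost c f.
  by apply: min_cost_attained; apply: leq_trans (subset_leq_card (finset.subD1set _ _)) (ltnW RB).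
have /is_matchingP[df jf vf] := mf.
have /is_matchingP[dg jg vg] := mg.
have gj : g j = None by apply/eqP; rewrite -[_ == _]negbK dg !inE (negPf jR) andbF.
have ij : i != j by apply: contraNneq jR => <-.
have Wp k : k \in alt_reach f g j -> k = j \/ k \in R :\ i.
  move=> kW; have [->|kj] := eqVneq k j; first by left.
  by right; have [v [_ _]] := alt_reach_pred kW kj; rewrite dg.
have jW := alt_reach_refl f g j.
have fresh k : f k = g j -> g j = None by [].
have m1 : is_matching R B (swap (alt_reach f g j) f g).
  apply: (swap_matching_fg mf mg) => //.
  - move=> k /Wp[->|]; rewrite !inE ?(negPf jR) ?andbF//.
    by move=> /andP[-> ->].
  - by move=> k kW; rewrite !inE; case: eqP => // kj; rewrite kj jW in kW.
  - by move=> k b _ /vg.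
  - by move=> k b _ /vf.
have m2 : is_matching ((j |: R) :\ i) B (swap (alt_reach f g j) g f).
  apply: (swap_matching_gf mf mg) => //.
  - move=> k /Wp[->|]; rewrite !inE ?eqxx/= ?(negPf jR) ?andbF//.
      by rewrite eq_sym ij.
    by move=> /andP[-> ->]; rewrite orbT.
  - by move=> k kW; rewrite !inE; case: (k =P j) => // kj; rewrite kj jW in kW.
  - by move=> k b _ /vf.
  - by move=> k b _ /vg.
by rewrite -(cost_swap c (alt_reach f g j)) lerD ?min_cost_le.
Qed.

Lemma matching_avoid A B f b : is_matching A B f ->
  (forall i, f i != Some b) -> is_matching A (B :\ b) f.
Proof.
move=> /is_matchingP[h1 h2 h3] nb; apply/is_matchingP; split=> // i b' fi.
rewrite !inE (h3 _ _ fi) andbT; apply: contraNneq (nb i) => <-.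
by rewrite fi.
Qed.

(** If the column [b] is useless for [R], that is min_cost c R B equals
    min_cost c R (B \ b), then it is useless for R \ i.  The exchange is made
    along the path that starts at the row matched to [b] by the second matching;
    all the rows of this path lie in R \ i, so that no domain changes. *)
Lemma min_cost_unused_sub c R i B b : i \in R -> b \in B ->
  (#|R| < #|B|)%N ->
  min_cost c R B + min_cost c (R :\ i) (B :\ b) <=
  min_cost c R (B :\ b) + min_cost c (R :\ i) B.
Proof.
move=> iR bB RB.
have cB : (#|R| <= #|B :\ b|)%N by rewrite (cardsD1 b) bB in RB.
have RiR : (#|R :\ i| <= #|R|)%N by apply: subset_leq_card (finset.subD1set _ _).
have [f mf ->] := min_cost_attained c cB.
have [g mg ->] := min_cost_attained c (leq_trans RiR (ltnW RB)).
have /is_matchingP[df jf vf] := mf.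
have /is_matchingP[dg jg vg] := mg.
have [/existsP[w /eqP gw]|/existsPn nb] := boolP [exists w, g w == Some b]; last first.
  rewrite lerD ?min_cost_le//; first exact: is_matching_sub (finset.subD1set _ _) mf.
  exact: matching_avoid.
have nfb k : f k <> Some b by move=> /vf; rewrite !inE eqxx.
have fresh k : f k = g w -> g w = None by rewrite gw => /nfb.
have Wp k : k \in alt_reach f g w -> k \in R :\ i.
  move=> kW; rewrite -dg; have [->|kj] := eqVneq k w; first by rewrite gw.
  by have [v [_ _]] := alt_reach_pred kW kj.
have wW := alt_reach_refl f g w.
have m1 : is_matching R B (swap (alt_reach f g w) f g).
  apply: (swap_matching_fg mf mg) => //.
  - by move=> k /Wp; rewrite !inE => /andP[-> ->].
  - by move=> k b' _ /vg.
  - by move=> k b' _ /vf; rewrite !inE => /andP[].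
have m2 : is_matching (R :\ i) (B :\ b) (swap (alt_reach f g w) g f).
  apply: (swap_matching_gf mf mg) => //.
  - by move=> k /Wp; rewrite !inE => /andP[-> ->].
  - by move=> k b' _ /vf.
  - move=> k b' kW gk; rewrite !inE (vg _ _ gk) andbT.
    apply: contraNneq kW => bb'.
    by rewrite (jg k w)// gk ?bb' ?gw.
by rewrite -(cost_swap c (alt_reach f g w)) lerD ?min_cost_le.
Qed.

(** Equality case of [min_cost_supermodular].  Follow the alternating path from
    the row that uses [b] in the best matching of (j |: R) \ i.  If it meets [j],
    the exchange yields matchings of j |: R and R \ i.  If it does not, the
    exchange moves [b] to the matching of [R] at no gain, so that (j |: R) \ i
    could do without [b], against the last hypothesis. *)
Lemma min_cost_submodular_used c R i j B b : i \in R -> j \notin R -> b \in B ->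
  (#|R| < #|B|)%N ->
  min_cost c R B = min_cost c R (B :\ b) ->
  min_cost c ((j |: R) :\ i) B < min_cost c ((j |: R) :\ i) (B :\ b) ->
  min_cost c (j |: R) B + min_cost c (R :\ i) B <=
  min_cost c R B + min_cost c ((j |: R) :\ i) B.
Proof.
move=> iR jR bB RB unused_b used_b.
have cB : (#|R| <= #|B :\ b|)%N by rewrite (cardsD1 b) bB in RB.
have cj : #|(j |: R) :\ i| = #|R|.
  by have := cardsD1 i (j |: R); rewrite cardsU1 jR !inE iR orbT => -[].
have [f mf fE] := min_cost_attained c cB.
have [g mg gE] : exists2 g, is_matching ((j |: R) :\ i) B g &
    min_cost c ((j |: R) :\ i) B = cost c g.
  by apply: min_cost_attained; rewrite cj ltnW.
have /is_matchingP[df jf vf] := mf.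
have /is_matchingP[dg jg vg] := mg.
have [/existsP[w /eqP gw]|/existsPn nb] := boolP [exists w, g w == Some b]; last first.
  by move: used_b; rewrite gE ltNge min_cost_le//; exact: matching_avoid.
have nfb k : f k <> Some b by move=> /vf; rewrite !inE eqxx.
have fresh k : f k = g w -> g w = None by rewrite gw => /nfb.
have Wp k : k \in alt_reach f g w -> k \in (j |: R) :\ i.
  move=> kW; rewrite -dg; have [->|kj] := eqVneq k w; first by rewrite gw.
  by have [v [_ _]] := alt_reach_pred kW kj.
have wW := alt_reach_refl f g w.
(* The path may end at [j], which only the second matching covers. *)
have [jW|jW] := boolP (j \in alt_reach f g w).
  have m1 : is_matching (j |: R) B (swap (alt_reach f g w) f g).
    apply: (swap_matching_fg mf mg) => //.
    - by move=> k /Wp; rewrite !inE => /andP[-> ->].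
    - by move=> k kW; rewrite !inE; case: eqP => // kj; rewrite kj jW in kW.
    - by move=> k b' _ /vg.
    - by move=> k b' _ /vf; rewrite !inE => /andP[].
  have m2 : is_matching (R :\ i) B (swap (alt_reach f g w) g f).
    apply: (swap_matching_gf mf mg) => //.
    - by move=> k /Wp; rewrite !inE => /andP[-> _].
    - by move=> k kW; rewrite !inE; case: (k =P j) => // kj; rewrite kj jW in kW.
    - by move=> k b' _ /vf; rewrite !inE => /andP[].
    - by move=> k b' _ /vg.
  by rewrite unused_b fE gE -(cost_swap c (alt_reach f g w)) lerD ?min_cost_le.
have m1 : is_matching R B (swap (alt_reach f g w) f g).
  apply: (swap_matching_fg mf mg) => //.
  - move=> k kW; have := Wp _ kW; rewrite !inE => /andP[-> /=].
    by case: eqP => // kj; rewrite -kj kW in jW.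
  - by move=> k b' _ /vg.
  - by move=> k b' _ /vf; rewrite !inE => /andP[].
have m2 : is_matching ((j |: R) :\ i) (B :\ b) (swap (alt_reach f g w) g f).
  apply: (swap_matching_gf mf mg) => //.
  - move=> k kW; have := Wp _ kW; rewrite !inE => /andP[-> /=].
    by case: eqP => // kj; rewrite -kj kW in jW.
  - by move=> k b' _ /vf.
  - move=> k b' kW gk; rewrite !inE (vg _ _ gk) andbT.
    apply: contraNneq kW => bb'.
    by rewrite (jg k w)// gk ?bb' ?gw.
have := lerD (min_cost_le c m1) (min_cost_le c m2).
by rewrite cost_swap -fE -gE unused_b lerD2l leNgt used_b.
Qed.

Definition upd c i b t : I -> J -> K :=
  fun k b' => if (k == i) && (b' == b) then t else c k b'.

Lemma updE c i b t : upd c i b t i b = t.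
Proof. by rewrite /upd !eqxx. Qed.

Lemma cost_upd c i b t f : f i != Some b -> cost (upd c i b t) f = cost c f.
Proof.
move=> fi; apply: eq_bigr => k _; case e : (f k) => [b'|]//=.
rewrite /upd; case: eqP => //= ki; case: eqP => //= bb'.
by rewrite -ki e bb' eqxx in fi.
Qed.

Lemma cost_upd_in c i b t f : f i = Some b ->
  cost (upd c i b t) f = t + (cost c f - c i b).
Proof.
move=> fi; rewrite /cost (bigD1 i)//= [X in _ = _ + (X - _)](bigD1 i)//= fi/= updE.
rewrite addrAC subrr add0r; congr (_ + _); apply: eq_bigr => k ki.
by case: (f k) => //= b'; rewrite /upd (negPf ki).
Qed.

Lemma eq_min_cost c c' A B : (#|A| <= #|B|)%N ->
  (forall f, is_matching A B f -> cost c f = cost c' f) ->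
  min_cost c A B = min_cost c' A B.
Proof.
move=> AB e; rewrite /min_cost e ?some_matchingP//.
by apply: eq_bigr.
Qed.

Lemma min_cost_upd_row c A B i b t : (#|A| <= #|B|)%N -> i \notin A ->
  min_cost (upd c i b t) A B = min_cost c A B.
Proof.
move=> AB iA; apply: eq_min_cost => // f /is_matchingP[h _ _].
by rewrite cost_upd//; apply: contraNneq iA => fi; rewrite -h fi.
Qed.

Lemma min_cost_upd_col c A B i b t : (#|A| <= #|B|)%N -> b \notin B ->
  min_cost (upd c i b t) A B = min_cost c A B.
Proof.
move=> AB bB; apply: eq_min_cost => // f /is_matchingP[_ _ h].
by rewrite cost_upd//; apply: contraNneq bB => /h.
Qed.

Lemma card_remove A B i b : i \in A -> b \in B -> (#|A| <= #|B|)%N ->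
  (#|A :\ i| <= #|B :\ b|)%N.
Proof. by move=> iA bB; rewrite (cardsD1 i) iA (cardsD1 b B) bB. Qed.

Lemma min_cost_le_extend c A B i b : i \in A -> b \in B -> (#|A| <= #|B|)%N ->
  min_cost c A B <= c i b + min_cost c (A :\ i) (B :\ b).
Proof.
move=> iA bB AB; have := card_remove iA bB AB.
move=> /(min_cost_attained c)[f mf ->].
rewrite -(cost_extend _ _ (is_matching_sub (finset.subD1set _ _) mf)).
by apply: min_cost_le; exact: is_matching_extend.
Qed.

(** Lowering one entry to [t] only adds a new competitor, the matchings that use
    this entry, to the minimum. *)
Lemma min_cost_upd c A B i b t : i \in A -> b \in B -> (#|A| <= #|B|)%N ->
  t <= c i b ->
  min_cost (upd c i b t) A B =
  Num.min (min_cost c A B) (t + min_cost c (A :\ i) (B :\ b)).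
Proof.
move=> iA bB AB tc; apply/eqP; rewrite eq_le; apply/andP; split.
  rewrite le_min; apply/andP; split.
    have [f mf ->] := min_cost_attained c AB.
    apply: le_trans (min_cost_le _ mf) _; apply: ler_sum => k _.
    by case: (f k) => //= b'; rewrite /upd; case: ifP => // /andP[/eqP-> /eqP->].
  apply: le_trans (min_cost_le_extend (upd c i b t) iA bB AB) _.
  by rewrite updE min_cost_upd_row ?card_remove// !inE eqxx.
have [f mf ->] := min_cost_attained (upd c i b t) AB.
rewrite ge_min; have [fi|fi] := eqVneq (f i) (Some b).
  apply/orP; right; rewrite (cost_remove _ fi mf) updE lerD2l cost_upd.
    by apply: min_cost_le; exact: is_matching_remove.
  by rewrite ffunE !inE eqxx.
by rewrite cost_upd// min_cost_le.
Qed.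

(** Column [b] is not needed by the best matching of [R]; the definition through
    costs does not require a unique best matching. *)
Definition unused c R b := min_cost c R [set: J] == min_cost c R ([set: J] :\ b).

(** The best matching of j |: R can be chosen through (i, b), although [R] does
    not need the column [b]. *)
Definition new_edge c R j i b := unused c R b &&
  (c i b + min_cost c ((j |: R) :\ i) ([set: J] :\ b) == min_cost c (j |: R) [set: J]).

Definition marginal c R i := min_cost c R [set: J] - min_cost c (R :\ i) [set: J].

Section NewEdge.
Variables (c : I -> J -> K) (R : {set I}) (j i : I) (b : J) (t : K).
Hypotheses (c0 : forall i b, 0 <= c i b) (jR : j \notin R) (RJ : (#|R| < #|J|)%N).
Hypothesis (iR : i \in j |: R).

Local Notation p := (marginal c R i).
Local Notation q := (marginal c (j |: R) i).

Let RT : (#|R| < #|[set: J]|)%N. Proof. by rewrite cardsT. Qed.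
Let RTb : (#|R| <= #|[set: J] :\ b|)%N.
Proof. by move: RJ; rewrite -[X in (_ < X)%N -> _]cardsT (cardsD1 b [set: J]) finset.in_setT. Qed.
Let R1T : (#|j |: R| <= #|[set: J]|)%N. Proof. by rewrite cardsT cardsU1 jR. Qed.
Let R1iTb : (#|(j |: R) :\ i| <= #|[set: J] :\ b|)%N.
Proof. exact: card_remove iR (finset.in_setT b) R1T. Qed.

Let same_row : i \notin R -> (j |: R) :\ i = R.
Proof.
move: iR; rewrite !inE => /orP[/eqP->|->//] _.
by rewrite finset.setU1K.
Qed.

Lemma marginal_ge0 : 0 <= p.
Proof.
by rewrite /marginal subr_ge0; apply: min_cost_sub_row => //; [exact: ltnW|exact: finset.subD1set].
Qed.

Lemma marginal_mono : p <= q.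
Proof.
rewrite /marginal; have [iR'|iR'] := boolP (i \in R).
  have := min_cost_supermodular c iR' jR RT; lra.
rewrite same_row// (_ : R :\ i = R) ?subrr ?subr_ge0; last first.
  by apply/finset.setP => k; rewrite !inE; case: eqP => // ->; rewrite (negPf iR').
by apply: min_cost_sub_row => //; apply: finset.subsetU1.
Qed.

Lemma new_edge_upd : t <= c i b ->
  new_edge (upd c i b t) R j i b =
  (Num.min (min_cost c R [set: J]) (if i \in R then t + min_cost c (R :\ i) ([set: J] :\ b)
     else min_cost c R [set: J]) == min_cost c R ([set: J] :\ b)) &&
  (t + min_cost c ((j |: R) :\ i) ([set: J] :\ b) <= min_cost c (j |: R) [set: J]).
Proof.
move=> tc; rewrite /new_edge /unused updE.
rewrite (min_cost_upd_col _ _ _ RTb) ?inE ?eqxx//.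
rewrite (min_cost_upd_col _ _ _ R1iTb) ?inE ?eqxx//.
rewrite (min_cost_upd iR _ R1T)// [X in _ && X]eq_sym -[X in _ && X]/(_ == _).
congr (_ && _); last by rewrite eq_minr.
case: ifPn => iR'; last by rewrite minxx min_cost_upd_row// ltnW.
by rewrite (min_cost_upd iR' _ (ltnW RT)).
Qed.

(** Lowering an entry of a column that [R] uses can only make that column more
    attractive. *)
Lemma new_edge_used : ~~ unused c R b -> t <= c i b ->
  ~~ new_edge (upd c i b t) R j i b.
Proof.
move=> used tc; rewrite new_edge_upd//; apply: contra used => /andP[/eqP e _].
rewrite /unused eq_le min_cost_sub_col ?finset.subD1set//= -e.
by rewrite ge_min lexx.
Qed.

(** The lower bound expresses that the column [b] remains unused by [R] when the
    entry is lowered to [t], the upper bound that the entry is cheap enough for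
    the best matching of j |: R. *)
Lemma new_edge_bounds : unused c R b -> 0 <= t <= c i b ->
  new_edge (upd c i b t) R j i b -> p <= t <= q.
Proof.
move=> /eqP unused_b /andP[t0 tc]; rewrite new_edge_upd// -unused_b.
move=> /andP[h1 h2]; apply/andP; split; last first.
  have := min_cost_sub_col c R1iTb (finset.subD1set _ _); rewrite /marginal; lra.
rewrite /marginal; case: ifPn h1 => iR' h1.
  move: h1; rewrite eq_minl => h1.
  have := min_cost_unused_sub c iR' (finset.in_setT b) RT.
  rewrite -unused_b; lra.
rewrite (_ : R :\ i = R) ?subrr//.
by apply/finset.setP => k; rewrite !inE; case: eqP => // ->; rewrite (negPf iR').
Qed.

(** If the column [b], unused by [R], were used by (j |: R) \ i, then the two
    bounds would coincide by [min_cost_submodular_used] and the interval would be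
    empty.  So [b] is unused there too, which also places the interval below
    [c i b]. *)
Lemma new_edge_between : unused c R b -> p <= t < q ->
  t < c i b /\ new_edge (upd c i b t) R j i b.
Proof.
move=> unused_b /andP[pt tq]; have /eqP ub := unused_b.
have still_unused : min_cost c ((j |: R) :\ i) [set: J] =
    min_cost c ((j |: R) :\ i) ([set: J] :\ b).
  apply/eqP; rewrite eq_le min_cost_sub_col ?finset.subD1set//= leNgt; apply/negP => lt.
  have [iR'|iR'] := boolP (i \in R).
    have := min_cost_submodular_used iR' jR (finset.in_setT b) RT ub lt.
    move: pt tq; rewrite /marginal; lra.
  by move: lt; rewrite (same_row iR') -ub ltxx.
have tc : t < c i b.
  apply: lt_le_trans tq _; rewrite /marginal still_unused.
  have := min_cost_le_extend c iR (finset.in_setT b) R1T; lra.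
split=> //; rewrite (new_edge_upd (ltW tc)) -ub; apply/andP; split; last first.
  by rewrite -still_unused; move: tq; rewrite /marginal; lra.
case: ifPn => iR'; last by rewrite minxx.
rewrite eq_minl; move: pt; rewrite /marginal.
have := min_cost_sub_col c (card_remove iR' (finset.in_setT b) (ltnW RT)) (finset.subD1set _ b); lra.
Qed.

End NewEdge.

(** Absence of ties; it makes best matchings unique. *)
Definition generic c := forall A B f g, is_matching A B f -> is_matching A B g ->
  cost c f = cost c g -> f = g.

Lemma card_matching_image A B f : is_matching A B f ->
  #|[set b | [exists i, f i == Some b]]| = #|A|.
Proof.
move=> /is_matchingP[h1 h2 h3].
rewrite -(card_in_imset (f := f) (D := A)); last first.
  by move=> i k iA kA e; apply: h2 => //; rewrite h1.
have Sinj : injective (@Some J) by move=> ? ? [].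
rewrite -(card_imset _ Sinj); apply: eq_card => -[b|].
  rewrite mem_imset//.
  rewrite inE; apply/existsP/imsetP => [[i /eqP fi]|[i iA ->]].
    by exists i => //; rewrite -h1 fi.
  by exists i.
apply/idP/idP => /imsetP[x]; first by [].
by rewrite -h1 => + e; rewrite -e eqxx.
Qed.

Lemma unusedP c R f b : generic c -> (#|R| < #|J|)%N ->
  is_matching R [set: J] f -> min_cost c R [set: J] = cost c f ->
  unused c R b = (b \notin [set b | [exists i, f i == Some b]]).
Proof.
move=> gen RJ mf fE.
have RTb : (#|R| <= #|[set: J] :\ b|)%N by move: RJ; rewrite -[X in (_ < X)%N -> _]cardsT (cardsD1 b [set: J]) finset.in_setT.
rewrite inE; apply/eqP/idP => [|nb]; last first.
  apply/eqP; rewrite eq_le min_cost_sub_col ?finset.subD1set//= fE.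
  apply: min_cost_le; apply: matching_avoid => // i.
  by move/existsPn: nb; apply.
have [g mg ->] := min_cost_attained c RTb.
have mg' := is_matching_sub (finset.subD1set _ _) mg.
rewrite fE => /(gen _ _ _ _ mf mg') ->; apply/existsPn => i.
apply/negP => /eqP gi; have /is_matchingP[_ _ /(_ _ _ gi)] := mg.
by rewrite !inE eqxx.
Qed.

Lemma card_unused c R : generic c -> (#|R| < #|J|)%N ->
  #|[set b | unused c R b]| = (#|J| - #|R|)%N.
Proof.
move=> gen RJ; have RT : (#|R| <= #|[set: J]|)%N by rewrite cardsT ltnW.
have [f mf fE] := min_cost_attained c RT.
rewrite -(card_matching_image mf) -[LHS](addnK #|[set b | [exists i, f i == Some b]]|).
congr (_ - _)%N; rewrite -(cardsC [set b | [exists i, f i == Some b]]) addnC.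
congr (_ + _)%N; apply: eq_card => b.
by rewrite [in LHS]inE (unusedP _ gen RJ mf fE) !inE.
Qed.

(** The columns of the best matching of [R] are among those of the best matching
    of j |: R by [min_cost_unused_sub], and exactly one column is added. *)
Lemma new_edge_unique c R j : generic c -> j \notin R -> (#|R| < #|J|)%N ->
  exists e : I * J, forall i b,
    (i \in j |: R) && new_edge c R j i b = ((i, b) == e).
Proof.
move=> gen jR RJ; have RT : (#|R| <= #|[set: J]|)%N by rewrite cardsT ltnW.
have R1T : (#|j |: R| <= #|[set: J]|)%N by rewrite cardsT cardsU1 jR.
have [f mf fE] := min_cost_attained c RT.
have [g mg gE] := min_cost_attained c R1T.
have uf b := unusedP b gen RJ mf fE.
have cf := card_matching_image mf.
have cg := card_matching_image mg.
have /is_matchingP[df jf _] := mf.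
have /is_matchingP[dg jg _] := mg.
(* A column avoided by [g] is unused by [j |: R], hence by [R]. *)
have sub : [set b | [exists i, f i == Some b]] \subset [set b | [exists i, g i == Some b]].
  apply/fintype.subsetP => b; rewrite -[b \in _]negbK -uf.
  apply: contraR; rewrite inE => /existsPn nb.
  have mg' := matching_avoid mg nb.
  have RTb : (#|j |: R| < #|[set: J]|)%N.
    rewrite (cardsD1 b [set: J]) finset.in_setT -(card_matching_image mg') ltnS.
    apply/subset_leq_card/fintype.subsetP => b'; rewrite !inE.
    by case/existsP => i /eqP gi; have /is_matchingP[_ _ /(_ _ _ gi)] := mg'; rewrite !inE.
  have := min_cost_unused_sub c (setU11 j R) (finset.in_setT b) RTb.
  rewrite finset.setU1K// /unused eq_le min_cost_sub_col ?finset.subD1set//=; last first.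
    by move: RJ; rewrite -[X in (_ < X)%N -> _]cardsT (cardsD1 b [set: J]) finset.in_setT.
  have : min_cost c (j |: R) ([set: J] :\ b) <= min_cost c (j |: R) [set: J].
    by rewrite gE min_cost_le.
  lra.
have : #|[set b | [exists i, g i == Some b]] :\: [set b | [exists i, f i == Some b]]| = 1%N.
  by rewrite cardsD (finset.setIidPr sub) cf cg cardsU1 jR addnK.
move=> /eqP/cards1P[b0 Eb0].
have : b0 \in [set b | [exists i, g i == Some b]] :\: [set b | [exists i, f i == Some b]].
  by rewrite Eb0 inE.
rewrite !inE => /andP[nf /existsP[i0 /eqP gi0]].
exists (i0, b0) => i b; apply/idP/eqP => [/and3P[iR ub /eqP e]|[-> ->]].
  have := ub; rewrite uf => nfb.
  have := card_remove iR (finset.in_setT b) R1T => /(min_cost_attained c)[h mh hE].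
  have gi : g i = Some b.
    suff -> : g = extend h i b by rewrite ffunE eqxx.
    apply: (gen _ _ _ _ mg (is_matching_extend iR (finset.in_setT b) mh)).
    by rewrite -gE -e hE (cost_extend _ _ mh).
  have bb0 : b = b0.
    apply/eqP; rewrite -finset.in_set1 -Eb0 finset.in_setD nfb/= inE.
    by apply/existsP; exists i; rewrite gi.
  by rewrite bb0; congr (_, _); apply: jg; rewrite ?gi ?gi0 ?bb0.
have i0R : i0 \in j |: R by rewrite -dg gi0.
rewrite i0R /new_edge uf inE nf/= eq_le min_cost_le_extend// andbT.
rewrite gE (cost_remove _ gi0 mg) lerD2l min_cost_le//.
exact: is_matching_remove.
Qed.

End Matchings.

Local Open Scope classical_set_scope.

(** * The sum of the inverse squares *)

Section Basel.
Variable R : realType.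

(** Both bounds come from the mean value theorem, as the cosine decreases from 1. *)
Lemma sin_bounds (x : R) : 0 < x < pi / 2 -> x * cos x <= sin x <= x.
Proof.
move=> /andP[x0 xpi]; have pi0 := pi_gt0 R.
have [|y] := @MVT R sin cos 0 x x0 (fun y _ => is_derive_sin y).
  by apply: continuous_subspaceT; exact: continuous_sin.
rewrite in_itv/= => /andP[y0 yx]; rewrite sin0 !subr0 => ->.
rewrite mulrC; apply/andP; split.
  by rewrite ler_pM2r// ltW// ltr_cos// in_itv/=; apply/andP; split; lra.
by rewrite ger_pMl// cos_le1.
Qed.

(** The two bounds are the squares of 1 / tan x <= 1 / x <= 1 / sin x. *)
Lemma inv_sqr_bounds (x : R) : 0 < x < pi / 2 ->
  (sin x ^+ 2)^-1 - 1 <= (x ^+ 2)^-1 <= (sin x ^+ 2)^-1.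
Proof.
move=> xb; have /andP[lo hi] := sin_bounds xb; have /andP[x0 xpi] := xb.
have s0 : 0 < sin x by apply: sin_gt0_pihalf.
have c0 : 0 < cos x by apply: cos_gt0_pihalf; apply/andP; split => //; lra.
apply/andP; split; last by rewrite lef_pV2 ?posrE ?exprn_gt0// ler_sqr// nnegrE ltW.
have -> : (sin x ^+ 2)^-1 - 1 = (cos x / sin x) ^+ 2.
  have := cos2sin2 x => e; rewrite expr_div_n e mulrBl mul1r divff//.
  by rewrite expf_neq0// gt_eqF.
rewrite -exprVn ler_sqr ?nnegrE ?invr_ge0 ?divr_ge0 ?(ltW x0) ?(ltW s0) ?(ltW c0)//.
by rewrite ler_pdivrMr// mulrC ler_pdivlMr// mulrC.
Qed.

Definition angle (a : nat) : R := pi / 2 ^+ a.+1.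

Lemma angleS a : angle a = angle a.+1 *+ 2.
Proof.
have : 2 ^+ a.+1 != 0 :> R by rewrite expf_neq0.
by rewrite /angle [in RHS]exprS -mulr_natl; move: (2 ^+ a.+1 : R) => y y0; field.
Qed.

Lemma angle_pow a : (2 ^ a)%N%:R * angle a = pi / 2.
Proof.
have : 2 ^+ a != 0 :> R by rewrite expf_neq0.
by rewrite /angle exprS natrX; move: (2 ^+ a : R) => y y0; field.
Qed.

(** Comparing 1 / x^2 with 1 / (sin x)^2 at the points k pi / 2^(a + 1) turns the
    sum of the 1 / k^2 into this sum, which the duplication formula computes. *)
Definition cosec2_sum (a : nat) : R :=
  \sum_(1 <= k < 2 ^ a) (sin (k%:R * angle a) ^+ 2)^-1.

(** Reflection x -> pi - x: the terms below and above the middle one, where the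
    sine is 1, agree. *)
Lemma cosec2_sum_full a :
  \sum_(1 <= k < 2 ^ a.+1) (sin (k%:R * angle a) ^+ 2)^-1 = 2 * cosec2_sum a + 1.
Proof.
have pow0 : (0 < 2 ^ a)%N by rewrite expn_gt0.
have E : (2 ^ a.+1 = 2 ^ a + 2 ^ a)%N by rewrite expnS mul2n addnn.
rewrite (big_cat_nat (n := 2 ^ a))//=; last by rewrite E leq_addr.
rewrite -/(cosec2_sum a) big_ltn ?E; last by rewrite -[X in (X < _)%N]addn0 ltn_add2l.
rewrite angle_pow sin_pihalf expr1n invr1.
have -> : \sum_((2 ^ a).+1 <= k < 2 ^ a + 2 ^ a) (sin (k%:R * angle a) ^+ 2)^-1
    = cosec2_sum a.
  rewrite -add1n big_addn addnK big_nat_rev/=; apply: eq_big_nat => k /andP[k1 k2].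
  rewrite add1n subSS.
  have -> : ((2 ^ a - k + 2 ^ a)%N%:R * angle a) = pi - k%:R * angle a.
    rewrite natrD natrB ?(ltnW k2)// mulrDl mulrBl angle_pow; lra.
  by rewrite sinB sinpi cospi mul0r sub0r mulN1r opprK.
ring.
Qed.

(** Pairing x with pi / 2 - x, one has
    1 / (sin x)^2 + 1 / (cos x)^2 = 4 / (sin 2x)^2. *)
Lemma cosec2_sumS a : cosec2_sum a.+1 = 4 * cosec2_sum a + 2.
Proof.
pose x k : R := k%:R * angle a.+1.
have xb k : (1 <= k < 2 ^ a.+1)%N -> 0 < x k < pi / 2.
  move=> /andP[k1 k2]; have a0 : 0 < angle a.+1.
    by rewrite divr_gt0 ?pi_gt0// exprn_gt0.
  apply/andP; split; first by rewrite mulr_gt0// ltr0n.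
  by rewrite -(angle_pow a.+1) ltr_pM2r// ltr_nat.
have rev : cosec2_sum a.+1 = \sum_(1 <= k < 2 ^ a.+1) (cos (x k) ^+ 2)^-1.
  rewrite /cosec2_sum big_nat_rev/=; apply: eq_big_nat => k /andP[k1 k2].
  rewrite add1n subSS natrB ?(ltnW k2)// mulrBl angle_pow.
  by rewrite sinB sin_pihalf cos_pihalf mul1r mul0r subr0.
have : cosec2_sum a.+1 *+ 2 =
    4 * \sum_(1 <= k < 2 ^ a.+1) (sin (k%:R * angle a) ^+ 2)^-1.
  rewrite mulr2n {2}rev /cosec2_sum -big_split mulr_sumr/=.
  apply: eq_big_nat => k kb; have /andP[x0 xpi] := xb _ kb.
  rewrite [angle a]angleS mulrnAr -/(x k) sin_mulr2n.
  have s0 : sin (x k) != 0 by rewrite gt_eqF// sin_gt0_pihalf// x0.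
  have c0 : cos (x k) != 0.
    by rewrite gt_eqF// cos_gt0_pihalf//; apply/andP; split=> //; lra.
  have e := cos2Dsin2 (x k).
  rewrite -mulr_natl; move: s0 c0 e; move: (sin _) (cos _) => s t s0 t0 e.
  transitivity ((t ^+ 2 + s ^+ 2) / (s ^+ 2 * t ^+ 2)); first by field; rewrite s0 t0.
  by rewrite e; field; rewrite s0 t0.
rewrite cosec2_sum_full => e; lra.
Qed.

Lemma cosec2_sumE a : cosec2_sum a = 2 / 3 * (4 ^+ a - 1).
Proof.
elim: a => [|a IH]; first by rewrite /cosec2_sum big_geq// expr0 subrr mulr0.
by rewrite cosec2_sumS IH exprS; field.
Qed.

Definition inv_sqr_sum (n : nat) : R := \sum_(l < n) (l.+1%:R ^+ 2)^-1.

Lemma inv_sqr_sum_nd m n : (m <= n)%N -> inv_sqr_sum m <= inv_sqr_sum n.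
Proof.
move=> mn; rewrite /inv_sqr_sum -!(big_mkord xpredT (fun l => (l.+1%:R ^+ 2)^-1)).
rewrite [leRHS](big_cat_nat (n := m))//= lerDl; apply: sumr_ge0 => i _.
by rewrite invr_ge0 exprn_ge0.
Qed.

Lemma inv_sqr_sum_bounds a :
  pi ^+ 2 / 6 - pi ^+ 2 / 2 ^+ a <= inv_sqr_sum (2 ^ a).-1 <= pi ^+ 2 / 6.
Proof.
have th0 : 0 < angle a by rewrite divr_gt0 ?pi_gt0// exprn_gt0.
have E : inv_sqr_sum (2 ^ a).-1 = angle a ^+ 2 *
    \sum_(1 <= k < 2 ^ a) ((k%:R * angle a) ^+ 2)^-1.
  rewrite /inv_sqr_sum -(big_mkord xpredT (fun l => (l.+1%:R ^+ 2)^-1)).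
  rewrite big_add1 mulr_sumr; apply: eq_bigr => l _.
  have l0 : l.+1%:R != 0 :> R by rewrite pnatr_eq0.
  move: l0 (lt0r_neq0 th0); move: (l.+1%:R : R) (angle a) => x y x0 y0.
  by field; rewrite x0 y0.
have xb k : (1 <= k < 2 ^ a)%N -> 0 < k%:R * angle a < pi / 2.
  move=> /andP[k1 k2].
  apply/andP; split; first by rewrite mulr_gt0// ltr0n.
  by rewrite -(angle_pow a) ltr_pM2r// ltr_nat.
have hi : \sum_(1 <= k < 2 ^ a) ((k%:R * angle a) ^+ 2)^-1 <= cosec2_sum a.
  by apply: ler_sum_nat => k /xb/inv_sqr_bounds/andP[].
have lo : cosec2_sum a - 2 ^+ a <= \sum_(1 <= k < 2 ^ a) ((k%:R * angle a) ^+ 2)^-1.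
  apply: (@le_trans _ _ (\sum_(1 <= k < 2 ^ a) ((sin (k%:R * angle a) ^+ 2)^-1 - 1))).
    rewrite sumrB -/(cosec2_sum a) lerD2l lerN2 big_const_nat iter_addr_0.
    by rewrite -natrX ler_nat leq_subr.
  by apply: ler_sum_nat => k /xb/inv_sqr_bounds/andP[].
have pi0 := pi_gt0 R.
have P0 : 2 ^+ a != 0 :> R by rewrite expf_neq0.
have A : angle a ^+ 2 * cosec2_sum a = pi ^+ 2 / 6 - pi ^+ 2 / 6 / (2 ^+ a) ^+ 2.
  have -> : cosec2_sum a = 2 / 3 * ((2 ^+ a) ^+ 2 - 1).
    by rewrite cosec2_sumE -[in RHS]exprM mulnC exprM; congr (_ * (_ ^+ a - _)); ring.
  rewrite /angle [2 ^+ a.+1]exprS; move: P0; move: (2 ^+ a : R) => y y0.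
  by field.
have B : angle a ^+ 2 * 2 ^+ a = pi ^+ 2 / 4 / 2 ^+ a.
  by rewrite /angle [2 ^+ a.+1]exprS; move: P0; move: (2 ^+ a : R) => y y0; field.
rewrite E; apply/andP; split; last first.
  apply: (@le_trans _ _ (angle a ^+ 2 * cosec2_sum a)).
    by rewrite ler_pM2l// exprn_gt0.
  by rewrite A gerBl !divr_ge0// ?exprn_ge0// ltW.
apply: (@le_trans _ _ (angle a ^+ 2 * (cosec2_sum a - 2 ^+ a))); last first.
  by rewrite ler_pM2l// exprn_gt0.
rewrite mulrBr A B.
have P1 : 1 <= 2 ^+ a :> R by rewrite exprn_ege1// ler1n.
have i0 : 0 <= (2 ^+ a : R)^-1 <= 1.
  by rewrite invr_ge0 (le_trans _ P1)//= invf_le1// (lt_le_trans _ P1).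
have p20 : 0 <= pi ^+ 2 :> R by rewrite exprn_ge0// ltW.
move: p20; move: (pi ^+ 2 : R) => p p0.
rewrite expr2 invfM; move: i0; move: ((2 ^+ a)^-1 : R) => y /andP[y0 y1].
have : p * (y * y) <= p * y by rewrite ler_wpM2l// ler_piMl.
have : 0 <= p * y by rewrite mulr_ge0.
lra.
Qed.

(** Along the powers of 2 the partial sums are squeezed by [inv_sqr_sum_bounds];
    monotonicity extends this to all the partial sums. *)
Theorem basel : inv_sqr_sum @ \oo --> (pi ^+ 2 / 6 : R).
Proof.
have ub n : inv_sqr_sum n <= pi ^+ 2 / 6.
  have /andP[_] := inv_sqr_sum_bounds n; apply: le_trans.
  apply: inv_sqr_sum_nd; rewrite -ltnS prednK ?expn_gt0//.
  exact: ltn_expl.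
apply/cvgrPdist_le => e e0.
have : (fun a : nat => pi ^+ 2 * 2^-1 ^+ a : R) @ \oo --> pi ^+ 2 * 0.
  apply: cvgM; first exact: cvg_cst.
  by apply: cvg_expr; rewrite ger0_norm ?invr_ge0// invf_lt1// ltr1n.
rewrite mulr0 => /cvgrPdist_le/(_ e e0)[a _ /(_ a)]/=.
rewrite leqnn sub0r normrN => /(_ isT) small.
near=> n.
rewrite ger0_norm ?subr_ge0//.
have /andP[lo _] := inv_sqr_sum_bounds a.
have : inv_sqr_sum (2 ^ a).-1 <= inv_sqr_sum n.
  by apply: inv_sqr_sum_nd; near: n; exists (2 ^ a).-1.
have := le_trans (ler_norm _) small; rewrite exprVn.
lra.
Unshelve. all: by end_near.
Qed.

End Basel.

(** * Resampling one of several independent exponential variables *)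

Lemma measurable_setb d (T : measurableType d) (f : T -> bool) :
  measurable_fun setT f -> measurable [set x | f x].
Proof.
move=> mf; rewrite -[X in measurable X]setTI.
exact: (mf measurableT [set true]).
Qed.

Section ExponentialLaw.
Context {R : realType}.
Notation leb := (@lebesgue_measure R).
Variables (r : R) (mu : probability R R).
Hypotheses (r0 : 0 < r)
  (muE : forall B : set R, measurable B -> mu B = exponential_prob r B).

Lemma exponential_tail (t : R) : 0 <= t -> mu `]t, +oo[%classic = (expR (- r * t))%:E.
Proof.
move=> t0; pose N : set R := `]-oo, 0[%classic; pose B : set R := `[0, t]%classic.
have mN : measurable N by exact: measurable_itv.
have mB : measurable B by exact: measurable_itv.
have m0 : mu N = 0%E.
  rewrite muE// /exponential_prob integral0_eq// => x.
  by rewrite /N /= in_itv/= => x0; rewrite lt0_exponential_pdf.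
have -> : `]t, +oo[%classic = ~` (B `|` N) :> set R.
  apply/seteqP; split => x /=; rewrite /N /B /= !in_itv/= ?andbT.
    move=> tx [/andP[_ xt]|x0]; lra.
  move=> h; rewrite ltNge; apply/negP => xt; apply: h.
  by case: (leP 0 x) => x0; [left; rewrite xt|right].
rewrite probability_setC; last by apply: measurableU.
have -> : mu (B `|` N) = (mu B + mu N)%E.
  rewrite measureU//; apply/seteqP; split => // x.
  rewrite /N /B /= !in_itv/= => -[/andP[x0 _]]; lra.
have -> : mu B = (1 - (expR (- r * t))%:E)%E.
  rewrite muE//; move: t0; rewrite /B le_eqVlt => /orP[/eqP <-|t0].
    by rewrite set_itv1 /exponential_prob integral_set1 mulr0 expR0 subee.
  exact: exponential_prob_itv0c.
rewrite m0 adde0.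
by rewrite -[1%E]/(1%:E) -!EFinB; congr (_%:E); lra.
Qed.

(** By Fubini, the right-hand side is the integral over [D] of r times the tail
    exp (- r t), which is the density at t >= 0. *)
Lemma exponential_resample (D : set R) : measurable D ->
  mu D = (r%:E * \int[mu]_s leb (D `&` `[0%R, s[%classic))%E.
Proof.
move=> mD.
pose A := [set z : R * R | D z.1 /\ 0 <= z.1 < z.2].
have mA : measurable A.
  have -> : A = (D `*` setT) `&` [set z : R * R | 0 <= z.1 < z.2].
    apply/seteqP; split => [z [Dz h]|z [[Dz _] h]] //=.
  apply: measurableI; first exact: measurableX.
  apply: measurable_setb; apply: measurable_and.
    exact: measurable_fun_ler.
  exact: measurable_fun_ltr.
have fub : (\int[leb]_t mu (xsection A t) = \int[mu]_s leb (ysection A s))%E.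
  etransitivity; last (etransitivity; first exact: (indic_fubini_tonelli leb mu mA)).
    apply: eq_integral => t _.
    exact: (esym (congr1 (@^~ t) (indic_fubini_tonelli_FE mu mA))).
  apply: eq_integral => s _.
  exact: (congr1 (@^~ s) (indic_fubini_tonelli_GE leb mA)).
have <- : (\int[mu]_s leb (ysection A s) = \int[mu]_s leb (D `&` `[0%R, s[%classic))%E.
  apply: eq_integral => s _ /=; congr (leb _).
  apply/seteqP; split => t; rewrite /ysection/= inE /A/= in_itv//=.
rewrite -fub -ge0_integralZl//; last 2 first.
- exact: (measurable_fun_xsection mu mA).
- by rewrite lee_fin ltW.
rewrite muE// /exponential_prob [LHS]integral_mkcond.
apply: eq_integral => t _; rewrite patchE /=.
have [t0|t0] := ltP t 0.
  have -> : xsection A t = set0.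
    apply/seteqP; split => // s; rewrite /xsection/= inE /A/= => -[_ /andP[]]; lra.
  by rewrite measure0 mule0; case: ifP => // _; rewrite lt0_exponential_pdf.
have [tD|tD] := boolP (t \in D); last first.
  have -> : xsection A t = set0.
    apply/seteqP; split => // s; rewrite /xsection/= inE /A/= => -[Dt _].
    by rewrite mem_set in tD.
  by rewrite measure0 mule0.
have -> : xsection A t = `]t, +oo[%classic.
  apply/seteqP; split => s; rewrite /xsection/= inE /A/= in_itv/= andbT.
    by move=> [_ /andP[]].
  by rewrite t0 => ->; split=> //; rewrite inE in tD.
by rewrite exponential_tail// exponential_pdfE.
Qed.

End ExponentialLaw.

(** Measurability of a function of finitely many real entries, tested on all
    measurable families; the lemmas on measurability of sums, minima and
    comparisons apply to it without a sigma-algebra on the function space. *)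
Definition measurable_functional (R : realType) (I : finType) dY
    (Y : measurableType dY) (Phi : (I -> R) -> Y) :=
  forall d (S : measurableType d) (g : I -> S -> R),
    (forall i, measurable_fun setT (g i)) ->
    measurable_fun setT (fun w => Phi (g^~ w)).

Definition reset (R : realType) (I : finType) (x : I -> R) (e : I) (t : R) : I -> R :=
  fun f => if f == e then t else x f.

Section Resampling.
Context d (T : measurableType d) (R : realType) (P : probability T R).
Variables (I : finType) (X : I -> {RV P >-> R}).
Hypothesis indep : mutually_independent X.
Variables (e : I) (r : R).
Hypotheses (r0 : 0 < r)
  (law : forall B : set R, measurable B -> distribution P (X e) B = exponential_prob r B).

Notation leb := (@lebesgue_measure R).

(** The events that fix a measurable condition on every variable except [X e]:
    a pi-system that generates the sigma-algebra of the other variables. *)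
Definition others : set (set T) := [set B | exists2 A : I -> set R,
  (forall i, measurable (A i)) &
  B = \bigcap_(i in [set` ~: [set e]]) (X i @^-1` A i)].

Local Notation T' := (g_sigma_algebraType others).

Let measurable_preim i (A : set R) : measurable A -> measurable (X i @^-1` A).
Proof.
by move=> mA; rewrite -[X in measurable X]setTI; exact: measurable_funP.
Qed.

Let others_measurable : others `<=` measurable.
Proof.
move=> _ [A mA ->]; apply: fin_bigcap_measurable => // i _.
exact: measurable_preim.
Qed.

Let others_setT : others setT.
Proof.
exists (fun=> setT) => //; apply/seteqP; split=> // w _ i _ //=.
Qed.

Let others_setI : setI_closed others.
Proof.
move=> _ _ [A mA ->] [B mB ->]; exists (fun i => A i `&` B i).
  by move=> i; exact: measurableI.
by rewrite -bigcapI.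
Qed.

Let sigma_others_measurable (B : set T) : <<s others >> B -> measurable B.
Proof. exact: (smallest_sub (@sigma_algebra_measurable _ T) others_measurable). Qed.

Let indep_generator (A : set R) B : measurable A -> others B ->
  P (X e @^-1` A `&` B) = (P (X e @^-1` A) * P B)%E.
Proof.
move=> mA [C mC ->].
rewrite (indep (J := ~: [set e]))//.
pose C' i := if i == e then A else C i.
have -> : X e @^-1` A `&` \bigcap_(i in [set` ~: [set e]]) (X i @^-1` C i) =
          \bigcap_(i in [set` [set: I]%SET]) (X i @^-1` C' i).
  apply/seteqP; split => [w [Aw Bw] i _|w h].
    rewrite /C'/=; case: eqP => [->//|/eqP ie].
    by apply: Bw; rewrite /= !inE.
  split; first by have := h e; rewrite /C' /= eqxx; apply; rewrite inE.
  move=> i /=; rewrite !inE => ie; have := h i.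
  by rewrite /C' /= (negPf ie); apply; rewrite inE.
rewrite (indep (J := [set: I]%SET)); last by move=> i _; rewrite /C'; case: ifP.
rewrite (bigD1 e) ?inE//= /C' eqxx; congr (_ * _)%E.
apply: eq_big => [i|i]; first by rewrite !inE.
by case/andP => _ ie; rewrite (negPf ie).
Qed.

Let indep_others (A : set R) (B : set T) : measurable A -> <<s others >> B ->
  P (X e @^-1` A `&` B) = (P (X e @^-1` A) * P B)%E.
Proof.
move=> mA sB; have mXA := measurable_preim e mA.
have fin : (P (X e @^-1` A) \is a fin_num)%E by exact: fin_num_measure.
pose k := NngNum (fine_ge0 (measure_ge0 P (X e @^-1` A))).
have cover : \bigcup_(k : nat) (setT : set T) = setT by rewrite bigcup_const.
have kE : k%:num%:E = P (X e @^-1` A) by rewrite /= fineK.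
(* Two finite measures that agree on the generating pi-system. *)
have : mrestr P mXA B = mscale k P B.
  apply: (@g_sigma_algebra_measure_unique _ R _ others others_measurable _
    (fun=> others_setT) cover (mrestr P mXA) (mscale k P) others_setI _ _ B sB).
    by move=> C oC; rewrite /= /mrestr /mscale kE setIC indep_generator.
  by move=> _; rewrite /= /mrestr setTI ltey_eq fin.
by rewrite /mrestr /mscale kE setIC.
Qed.

(** The sample space itself, with the sigma-algebra of the other variables,
    serves as the value space of the family of the other variables. *)
Let forget (w : T) : T' := w.

Let measurable_forget : measurable_fun setT forget.
Proof. by move=> _ B sB; rewrite setTI; exact: sigma_others_measurable. Qed.

Let forget_mixin := isMeasurableFun.Build _ _ _ _ _ measurable_forget.
Let forget_mfun : {mfun T >-> T'} := HB.pack forget forget_mixin.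

Let pair (w : T) : T' * R := (forget w, X e w).

Let measurable_pair : measurable_fun setT pair.
Proof. exact: measurable_fun_pair. Qed.

Let pair_mixin := isMeasurableFun.Build _ _ _ _ _ measurable_pair.
Let pair_mfun : {mfun T >-> (T' * R)%type} := HB.pack pair pair_mixin.

Let PG : probability T' R := distribution P forget_mfun.
Let mu : probability R R := distribution P (X e).
Let joint : probability (T' * R)%type R := distribution P pair_mfun.

(** Independence as a product law: a sample is distributed like a pair of
    independent components, the value of [X e] and all the rest. *)
Let jointE (A : set (T' * R)) : measurable A -> (PG \x mu)%E A = joint A.
Proof.
apply: product_measure_unique => B C mB mC.
rewrite /joint /PG /mu /= /distribution /pushforward /=.
rewrite muleC -indep_others//; congr (P _).
by apply/seteqP; split => w [].
Qed.

Let measurable_reset : forall i : I,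
  measurable_fun setT (fun z : T' * R => reset (X^~ (z.1 : T)) e z.2 i).
Proof.
move=> i; rewrite /reset; case: eqP => [_|/eqP ie]; first exact: measurable_snd.
apply: (measurableT_comp (f := X i : T' -> R)) => //.
move=> _ B mB; rewrite setTI; apply: sub_sigma_algebra.
exists (fun k => if k == i then B else setT); first by move=> k; case: ifP.
apply/seteqP; split => [w wB k _ /=|w /(_ i)/=]; first by case: eqP => [->|].
by rewrite !inE eqxx; apply.
Qed.

(** Integrate [X e] first, the other variables being fixed, by
    [exponential_resample]; then reassemble the joint law. *)
Lemma resample (Phi : (I -> R) -> bool) : measurable_functional Phi ->
  P [set w | Phi (X^~ w)] =
  (r%:E * \int[P]_w leb [set t | (0 <= t < X e w)%R && Phi (reset (X^~ w) e t)])%E.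
Proof.
move=> mPhi.
pose A := [set z : T' * R | Phi (reset (X^~ (z.1 : T)) e z.2)].
have mR : measurable_fun setT (fun z : T' * R => Phi (reset (X^~ (z.1 : T)) e z.2)).
  exact: mPhi measurable_reset.
have mA : measurable A by exact: measurable_setb.
pose B := [set z : (T' * R) * R |
  (0 <= z.2 < z.1.2) && Phi (reset (X^~ (z.1.1 : T)) e z.2)].
have mB : measurable B.
  apply: measurable_setb; apply: measurable_and.
    apply: measurable_and; first exact: measurable_fun_ler.
    by apply: measurable_fun_ltr => //; exact: measurableT_comp.
  apply: (measurableT_comp (f := fun z : T' * R => Phi (reset (X^~ (z.1 : T)) e z.2))
    (g := fun z : (T' * R) * R => (z.1.1, z.2)) mR).
  by apply: measurable_fun_pair => //; exact: measurableT_comp.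
pose h (z : T' * R) := leb (xsection B z).
have mh : measurable_fun setT h by exact: (measurable_fun_xsection leb mB).
have h0 z : (0 <= h z)%E by exact: measure_ge0.
transitivity (joint A).
  rewrite /joint /= /distribution /pushforward; congr (P _).
  apply/seteqP; split => w /=; rewrite /A/= => hw; move: hw; congr (is_true (Phi _));
  by apply/funext => i; rewrite /reset; case: eqP => // ->.
rewrite -jointE// /product_measure1.
transitivity (\int[PG]_w (r%:E * \int[mu]_s (leb (xsection B (w, s)))))%E.
  apply: eq_integral => w _ /=.
  rewrite (exponential_resample r0 law); last exact: measurable_xsection.
  congr (_ * _)%E; apply: eq_integral => s _; congr (leb _).
  apply/seteqP; split => t; rewrite /xsection /A /B /= in_itv/= !in_setE/=.
    by move=> [-> ->].
  by move=> /andP[-> ->].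
rewrite ge0_integralZl//; last 3 first.
- rewrite -[X in measurable_fun _ X]/(fubini_F mu h).
  exact: measurable_fun_fubini_tonelli_F.
- by move=> w _; apply: integral_ge0.
- by rewrite lee_fin ltW.
congr (_ * _)%E.
transitivity (\int[(PG \x mu)%E]_z h z)%E.
  by rewrite fubini_tonelli1.
rewrite (eq_measure_integral joint); last by move=> C mC _; exact: jointE.
rewrite ge0_integral_distribution//; apply: eq_integral => w _ /=.
by congr (leb _); apply/seteqP; split => t; rewrite /xsection /B /= in_setE.
Qed.

End Resampling.

(** * New edges in a random cost matrix *)

Section MeasurableCost.
Context d (T : measurableType d) (R : realType) (I J : finType).
Variable g : I -> J -> T -> R.
Hypothesis mg : forall i j, measurable_fun setT (g i j).
Let cw w : I -> J -> R := fun i j => g i j w.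

Lemma measurable_cost f : measurable_fun setT (fun w => cost (cw w) f).
Proof.
apply: measurable_sum => i; case: (f i) => [b|]; first exact: mg.
exact: measurable_cst.
Qed.

Lemma measurable_bigmin (K : Type) (s : seq K) (Q : pred K) (h0 : T -> R) (h : K -> T -> R) :
  measurable_fun setT h0 -> (forall k, measurable_fun setT (h k)) ->
  measurable_fun setT (fun w => \big[Order.min/h0 w]_(k <- s | Q k) h k w).
Proof.
move=> m0 mh; elim: s => [|k s IH].
  by under eq_fun do rewrite big_nil.
under eq_fun do rewrite big_cons; case: (Q k) => //.
exact: measurable_minr.
Qed.

Lemma measurable_min_cost A B : measurable_fun setT (fun w => min_cost (cw w) A B).
Proof. by apply: measurable_bigmin => [|f]; exact: measurable_cost. Qed.

Lemma measurable_unused A b : measurable_fun setT (fun w => unused (cw w) A b).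
Proof. by apply: measurable_fun_eqr; exact: measurable_min_cost. Qed.

Lemma measurable_new_edge A j i b :
  measurable_fun setT (fun w => new_edge (cw w) A j i b).
Proof.
apply: measurable_and; first exact: measurable_unused.
apply: measurable_fun_eqr; last exact: measurable_min_cost.
by apply: measurable_funD; [exact: mg|exact: measurable_min_cost].
Qed.

End MeasurableCost.

Lemma lebesgue_halfopen (R : realType) (x : R) :
  (@lebesgue_measure R `[0%R, x[%classic = (Num.max 0 x)%:E)%E.
Proof.
rewrite lebesgue_measure_itv/= lte_fin; case: ltP => x0.
  by rewrite oppr0 addr0.
by [].
Qed.

Lemma measurable_resample d (T : measurableType d) (R : realType) (I : finType)
    (X : I -> T -> R) (e : I) (Phi : (I -> R) -> bool) :
  (forall i, measurable_fun setT (X i)) -> measurable_functional Phi ->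
  measurable_fun setT (fun w => (@lebesgue_measure R)
    [set t | (0 <= t < X e w)%R && Phi (reset (X^~ w) e t)]).
Proof.
move=> mX mPhi.
pose B := [set z : T * R | (0 <= z.2 < X e z.1) && Phi (reset (X^~ z.1) e z.2)].
have mB : measurable B.
  apply: measurable_setb; apply: measurable_and.
    apply: measurable_and; first exact: measurable_fun_ler.
    by apply: measurable_fun_ltr => //; exact: measurableT_comp.
  apply: (mPhi _ _ (fun i (z : T * R) => reset (X^~ z.1) e z.2 i)) => i.
  rewrite /reset; case: eqP => _; first exact: measurable_snd.
  exact: measurableT_comp.
apply: eq_measurable_fun (measurable_fun_xsection lebesgue_measure mB) => w _ /=.
by congr (_ _); apply/seteqP; split => t; rewrite /xsection /B /= in_setE.
Qed.

Lemma measurable_upd (R : realType) (I J : finType) (x : I -> J -> R) i b k j :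
  measurable_fun setT (fun t : R => upd x i b t k j).
Proof. by rewrite /upd; case: ((k == i) && (j == b)). Qed.

Lemma measurable_indicator d (T : measurableType d) (R : realType) (h : T -> bool) :
  measurable_fun setT h -> measurable_fun setT (fun w => (h w)%:R : R).
Proof.
move=> mh; apply: eq_measurable_fun (measurable_indic (measurable_setb mh)).
move=> w _; rewrite indicE; congr ((nat_of_bool _)%:R).
by apply/idP/idP; rewrite in_setE.
Qed.

Section Assignment.
Context d (T : measurableType d) (R : realType) (P : probability T R).
Variables (I J : finType) (c : I -> J -> {RV P >-> R}) (r : R).
Hypotheses (r0 : 0 < r)
  (c_exp : forall i j (B : set R), measurable B ->
     distribution P (c i j) B = exponential_prob r B)
  (indep : mutually_independent (fun ij : I * J => c ij.1 ij.2)).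
Notation leb := (@lebesgue_measure R).

Local Notation cw w := (fun i j => c i j w).

Let resample_entry (i : I) (b : J) (Phi : (I -> J -> R) -> bool) :
  measurable_functional (fun x : I * J -> R => Phi (fun i j => x (i, j))) ->
  P [set w | Phi (cw w)] =
  (r%:E * \int[P]_w leb [set t | (0 <= t < c i b w)%R && Phi (upd (cw w) i b t)])%E.
Proof.
move=> mPhi; have := resample indep r0 (e := (i, b)) (c_exp i b) mPhi.
exact.
Qed.

Let measurable_resample_entry (i : I) (b : J) (Phi : (I -> J -> R) -> bool) :
  measurable_functional (fun x : I * J -> R => Phi (fun i j => x (i, j))) ->
  measurable_fun setT
    (fun w => leb [set t | (0 <= t < c i b w)%R && Phi (upd (cw w) i b t)]).
Proof.
move=> mPhi; have mc (e : I * J) : measurable_fun setT (c e.1 e.2) by [].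
have := measurable_resample (i, b) mc mPhi.
exact.
Qed.

Lemma costs_ge0 : {ae P, forall w, forall i j, 0 <= cw w i j}.
Proof.
have h (ij : I * J) : {ae P, forall w, 0 <= c ij.1 ij.2 w}.
  exists (c ij.1 ij.2 @^-1` `]-oo, 0[); split.
  - rewrite -[X in measurable X]setTI; exact: measurable_funP.
  - rewrite -[LHS]/(distribution P (c ij.1 ij.2) `]-oo, 0[%classic) c_exp//.
    rewrite /exponential_prob integral0_eq// => x.
    by rewrite /= in_itv/= => x0; rewrite lt0_exponential_pdf.
  - by move=> w /=; rewrite in_itv/= ltNge => /negP.
apply: filterS (filter_forall (ae_filter_ringOfSetsType P) h) => w hw i j.
exact: (hw (i, j)).
Qed.

(** The first matching uses the entry (i, b) and the second one does not: there is
    a single value of that entry that makes the costs equal. *)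
Lemma distinct_costs (f g : {ffun I -> option J}) i b :
  f i = Some b -> g i != Some b ->
  P [set w | cost (cw w) f == cost (cw w) g] = 0%E.
Proof.
move=> fi gi.
rewrite (resample_entry i b (Phi := fun x => cost x f == cost x g)); last first.
  by move=> d' S g' mg; apply: measurable_fun_eqr; exact: measurable_cost.
rewrite integral0_eq ?mule0// => w _.
apply: (@subset_measure0 _ _ _ leb _ [set cost (cw w) g - (cost (cw w) f - c i b w)]).
- apply: measurable_setb; apply: measurable_and.
    apply: measurable_and; first exact: measurable_fun_ler.
    exact: measurable_fun_ltr.
  by apply: measurable_fun_eqr; apply: (measurable_cost (measurable_upd (cw w) i b)).
- exact: measurable_set1.
- by move=> t /= /andP[_ /eqP]; rewrite (cost_upd _ _ gi) (cost_upd_in _ _ fi) => <-; rewrite addrK.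
- exact: lebesgue_measure_set1.
Qed.

Lemma generic_ae : {ae P, forall w, generic (cw w)}.
Proof.
pose same_dom (f g : {ffun I -> option J}) :=
  [forall i, (f i != None) == (g i != None)].
have h (fg : {ffun I -> option J} * {ffun I -> option J}) :
    {ae P, forall w, same_dom fg.1 fg.2 -> fg.1 != fg.2 ->
       cost (cw w) fg.1 <> cost (cw w) fg.2}.
  case: fg => f g /=; have [sd|] := boolP (same_dom f g); last by move=> _; exact: aeW.
  have [->|fg] := eqVneq f g; first exact: aeW.
  have [i fgi] : exists i, f i != g i.
    apply/existsP; apply: contra_neqT fg => /existsPn fg; apply/ffunP => i.
    by apply/eqP; rewrite -[_ == _]negbK fg.
  have [b fi] : exists b, f i = Some b.
    move/forallP: sd => /(_ i); case e : (f i) => [b|]; first by exists b.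
    by move: fgi; rewrite e eqxx /=; case: (g i).
  exists [set w | cost (cw w) f == cost (cw w) g]; split.
  - by apply: measurable_setb; apply: measurable_fun_eqr; exact: measurable_cost.
  - by apply: (distinct_costs fi); rewrite -fi eq_sym.
  - by move=> w /= nh; apply/eqP; apply: contrapT => ne; apply: nh.
apply: filterS (filter_forall (ae_filter_ringOfSetsType P) h) => w hw A B f g mf mg e.
apply/eqP; apply: contraPT (e) => fg; apply: (hw (f, g)) => //=.
apply/forallP => i.
have /is_matchingP[-> _ _] := mf.
by have /is_matchingP[-> _ _] := mg.
Qed.

(** Resampling the certain event shows that r times the mean of an entry is 1. *)
Lemma integrable_entry i b : P.-integrable setT (EFin \o c i b).
Proof.
apply/integrableP; split; first exact/measurable_EFinP.
have := resample_entry i b (Phi := fun=> true) (fun _ _ _ _ => measurable_cst _).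
rewrite (_ : [set w : T | true] = setT); last by apply/seteqP; split.
rewrite probability_setT => E.
suff -> : (\int[P]_w `|(EFin \o c i b) w| =
    \int[P]_w leb [set t | (0 <= t < c i b w)%R && true])%E.
  rewrite ltey; apply/eqP => oo; move: E; rewrite oo.
  by rewrite gt0_muley ?lte_fin.
apply: ae_eq_integral => //.
- by apply/measurableT_comp => //; exact/measurable_EFinP.
- apply: (measurable_resample_entry i b (Phi := fun=> true)) => ? ? ? ?; exact: measurable_cst.
apply: filterS (costs_ge0) => w hw _ /=.
rewrite ger0_norm//; transitivity (leb `[0%R, c i b w[%classic); last first.
  by congr (leb _); apply/seteqP; split => t; rewrite /= in_itv/= andbT.
by rewrite lebesgue_halfopen (max_idPr _).
Qed.

Lemma integrable_min_cost A B :
  P.-integrable setT (EFin \o (fun w => min_cost (cw w) A B)).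
Proof.
apply: (@le_integrable _ _ _ P setT measurableT _
    (fun w => \sum_i \sum_j `|(c i j w)%:E|)%E).
- by apply/measurable_EFinP; exact: measurable_min_cost.
- move=> w _ /=; rewrite [leRHS]gee0_abs; last first.
    by apply: sume_ge0 => i _; apply: sume_ge0.
  have [f ->] : exists f, min_cost (cw w) A B = cost (cw w) f.
    rewrite /min_cost; elim/big_ind: _ => [|x y [f ->] [g ->]|f _].
    - by exists (some_matching A B).
    - by case: (leP (cost (cw w) f) (cost (cw w) g)) => _; [exists f|exists g].
    - by exists f.
  rewrite /cost; apply: le_trans (_ : (\sum_i (`|oapp (fun j => c i j w) 0 (f i)|%R)%:E <= _)%E).
    by rewrite sumEFin lee_fin ler_norm_sum.
  apply: lee_sum => i _; case: (f i) => [b|] /=.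
    by rewrite (bigD1 b)//= leeDl// sume_ge0.
  by rewrite normr0 sume_ge0.
- apply: integrable_sum => // i _; apply: integrable_sum => // j _.
  exact: integrable_abse (integrable_entry i j).
Qed.

Lemma integrable_indicator (h : T -> bool) : measurable_fun setT h ->
  P.-integrable setT (EFin \o (fun w => (h w)%:R : R)).
Proof.
move=> mh; apply: le_integrable (finite_measure_integrable_cst P 1 measurableT) => //.
  by apply/measurable_EFinP; exact: measurable_indicator.
by move=> w _ /=; rewrite lee_fin; case: (h w); rewrite ?normr0.
Qed.

Definition expected_cost (A : {set I}) := (\int[P]_w min_cost (cw w) A [set: J]%SET)%R.

Section NewEdgeProbability.
Variables (A : {set I}) (j : I).
Hypotheses (jA : j \notin A) (AJ : (#|A| < #|J|)%N).

Local Notation X w B := (min_cost (cw w) B [set: J]%SET).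

(** The length of the interval of costs at which (i, b) becomes the new edge. *)
Definition increment i w : R := marginal (cw w) (j |: A)%SET i - marginal (cw w) A i.

Lemma measurable_increment i : measurable_fun setT (increment i).
Proof.
by apply: measurable_funB; apply: measurable_funB; exact: measurable_min_cost.
Qed.

Lemma integrable_increment i : P.-integrable setT (EFin \o increment i).
Proof.
have h B := integrable_min_cost B [set: J]%SET.
apply: (@integrableB _ _ _ P setT _ (EFin \o (fun w => X w _ - X w _)%R)
   (EFin \o (fun w => X w _ - X w _)%R)) => //.
- exact: (@integrableB _ _ _ P setT _ (EFin \o (fun w => X w _)%R)
   (EFin \o (fun w => X w _)%R)).
- exact: (@integrableB _ _ _ P setT _ (EFin \o (fun w => X w _)%R)
   (EFin \o (fun w => X w _)%R)).
Qed.

Lemma lebesgue_new_edge w i b : (forall i b, 0 <= c i b w) -> i \in (j |: A)%SET ->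
  leb [set t | (0 <= t < c i b w)%R && new_edge (upd (cw w) i b t) A j i b] =
  ((unused (cw w) A b)%:R * increment i w)%:E.
Proof.
move=> c0 iA.
have mS : measurable
    [set t | (0 <= t < c i b w)%R && new_edge (upd (cw w) i b t) A j i b].
  apply: measurable_setb; apply: measurable_and.
    apply: measurable_and; first exact: measurable_fun_ler.
    exact: measurable_fun_ltr.
  exact: (measurable_new_edge (measurable_upd (cw w) i b)).
have [ub|nub] := boolP (unused (cw w) A b); last first.
  rewrite mul0r (_ : [set t | _] = set0) ?measure0//.
  apply/seteqP; split => // t /= /andP[/andP[_ /ltW tc]].
  by apply/negP; exact: new_edge_used.
rewrite mul1r.
set p := marginal (cw w) A i; set q := marginal (cw w) (j |: A)%SET i.
have p0 : 0 <= p by exact: marginal_ge0.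
have pq : p <= q by exact: marginal_mono.
(* Ties may occur at the endpoints, which have length zero. *)
have lo : leb `[p, q[%classic = (q - p)%:E.
  rewrite lebesgue_measure_itv/= lte_fin; case: ltP => [_|qp].
    by rewrite EFinB.
  by congr (_%:E); lra.
have hi : leb `[p, q]%classic = (q - p)%:E.
  rewrite lebesgue_measure_itv/= lte_fin; case: ltP => [_|qp].
    by rewrite EFinB.
  by congr (_%:E); lra.
apply/eqP; rewrite eq_le; apply/andP; split.
  rewrite /increment -/p -/q -hi; apply: le_measure; rewrite ?inE//.
  move=> t /= /andP[/andP[t0 tc]]; rewrite in_itv/=.
  by apply: new_edge_bounds => //; rewrite t0 ltW.
rewrite /increment -/p -/q -lo; apply: le_measure; rewrite ?inE//.
move=> t /=; rewrite in_itv/= => ptq.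
have [tc ->] := new_edge_between jA AJ iA ub ptq.
by rewrite tc (le_trans p0)//; case/andP: ptq.
Qed.

Lemma prob_new_edge i b : i \in (j |: A)%SET ->
  P [set w | new_edge (cw w) A j i b] =
  (r%:E * \int[P]_w ((unused (cw w) A b)%:R * increment i w)%:E)%E.
Proof.
move=> iA; have mN : measurable_functional
    (fun x : I * J -> R => new_edge (fun i j => x (i, j)) A j i b).
  by move=> d' S g mg; exact: measurable_new_edge.
rewrite (resample_entry i b (Phi := fun x => new_edge x A j i b) mN).
congr (_ * _)%E; apply: ae_eq_integral => //.
- exact: (measurable_resample_entry i b (Phi := fun x => new_edge x A j i b) mN).
- apply/measurable_EFinP; apply: measurable_funM; last exact: measurable_increment.
  by apply: measurable_indicator; exact: measurable_unused.
apply: filterS costs_ge0 => w hw _; exact: lebesgue_new_edge.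
Qed.

Lemma integrable_indicator_increment i b :
  P.-integrable setT (EFin \o (fun w => (unused (cw w) A b)%:R * increment i w)).
Proof.
apply: le_integrable (integrable_increment i) => //.
  apply/measurable_EFinP; apply: measurable_funM; last exact: measurable_increment.
  by apply: measurable_indicator; exact: measurable_unused.
move=> w _ /=; rewrite lee_fin normrM ler_piMl//.
by case: (unused _ _ _); rewrite ?normr1 ?normr0.
Qed.

Lemma sum_prob_new_edge :
  (\sum_(i in (j |: A)%SET) \sum_(b : J) P [set w | new_edge (cw w) A j i b] = 1)%E.
Proof.
have mN i b : measurable_fun setT (fun w => (new_edge (cw w) A j i b)%:R : R).
  by apply: measurable_indicator; exact: measurable_new_edge.
transitivity (\sum_(i in (j |: A)%SET) \sum_(b : J)
    \int[P]_w ((new_edge (cw w) A j i b)%:R : R)%:E)%E.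
  apply: eq_bigr => i _; apply: eq_bigr => b _.
  rewrite -[Y in P Y]setIT -integral_indic//; last first.
    by apply: measurable_setb; exact: measurable_new_edge.
  apply: eq_integral => w _; rewrite indicE; congr ((nat_of_bool _)%:R%:E).
  by apply/idP/idP; rewrite in_setE.
transitivity (\int[P]_w (\sum_(i in (j |: A)%SET) \sum_(b : J)
    (new_edge (cw w) A j i b)%:R)%:E)%E; last first.
  rewrite -[RHS](probability_setT P) -[RHS]mul1e -integral_cst//.
  apply: ae_eq_integral => //.
    apply/measurable_EFinP; under eq_fun do rewrite big_mkcond/=.
    apply: measurable_sum => i.
    by case: (i \in (j |: A)%SET); [apply: measurable_sum => b|].
  apply: filterS generic_ae => w gen _ /=; congr (_%:E).
  have [[i0 b0] e] := new_edge_unique gen jA AJ.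
  rewrite pair_big_dep/= (bigD1 (i0, b0))/=; last first.
    by have := e i0 b0; rewrite eqxx => /andP[-> _].
  have := e i0 b0; rewrite eqxx => /andP[_ ->].
  rewrite big1 ?addr0// => -[i b] /= /andP[/andP[iA _] ne].
  by have := e i b; rewrite iA (negPf ne) /= => ->.
have iN i b : P.-integrable setT (EFin \o (fun w => (new_edge (cw w) A j i b)%:R : R)).
  by apply: integrable_indicator; exact: measurable_new_edge.
under [RHS]eq_integral do rewrite -sumEFin.
rewrite integral_sum//; last first.
  move=> i; under eq_fun do rewrite -sumEFin.
  by apply: integrable_sum => // b _; exact: iN.
apply: eq_bigr => i _; under [RHS]eq_integral do rewrite -sumEFin.
by rewrite integral_sum// => b; exact: iN.
Qed.

Lemma expected_increment i : \int[P]_w increment i w =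
  (expected_cost (j |: A)%SET - expected_cost ((j |: A) :\ i)%SET) -
  (expected_cost A - expected_cost (A :\ i)%SET).
Proof.
have h B := integrable_min_cost B [set: J]%SET.
have h2 B B' : P.-integrable setT (EFin \o (fun w => X w B - X w B')).
  exact: (@integrableB _ _ _ P setT _ (EFin \o (fun w => X w _)%R)
   (EFin \o (fun w => X w _)%R)).
by rewrite /increment /marginal RintegralB// !RintegralB.
Qed.

(** Sum [prob_new_edge] over all the entries of the rows in j |: A: each row has
    as many relevant columns as there are columns unused by [A]. *)
Lemma sum_expected_increment :
  r * (#|J| - #|A|)%:R * \sum_(i in (j |: A)%SET)
    ((expected_cost (j |: A)%SET - expected_cost ((j |: A) :\ i)%SET) -
     (expected_cost A - expected_cost (A :\ i)%SET)) = 1.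
Proof.
under eq_bigr do rewrite -expected_increment.
apply: EFin_inj; rewrite -[RHS]sum_prob_new_edge.
rewrite mulr_sumr -sumEFin; apply: eq_bigr => i iA.
under eq_bigr do rewrite prob_new_edge//.
rewrite -fin_num_sume_distrr//; last first.
  move=> b b' _ _; rewrite fin_num_adde_defl//.
  exact: (integrable_fin_num measurableT (integrable_indicator_increment i b')).
rewrite -mulrA EFinM; congr (_ * _)%E.
rewrite -(@integral_sum _ _ _ P setT measurableT _
  (fun b w => ((unused (cw w) A b)%:R * increment i w)%:E)); last first.
  exact: integrable_indicator_increment.
transitivity (\int[P]_w ((#|J| - #|A|)%:R * increment i w)%:E)%E.
  rewrite -RintegralZl//; last exact: integrable_increment.
  rewrite /Rintegral fineK// integrable_fin_num//.
  apply: eq_integrable (integrableZl measurableT _ (integrable_increment i)) => //.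
apply: ae_eq_integral => //.
- by apply/measurable_EFinP; apply: measurable_funM => //; exact: measurable_increment.
- apply: emeasurable_sum => b.
  have := integrable_indicator_increment i b; by case/integrableP.
apply: filterS generic_ae => w gen _ /=.
rewrite sumEFin -mulr_suml; congr ((_ * _)%:E).
by rewrite -(card_unused gen AJ) -sum1_card natr_sum big_mkcond; apply: eq_bigr => b _; rewrite inE; case: ifP.
Qed.

End NewEdgeProbability.

End Assignment.

(** * Mean costs *)

Definition partial_harmonic (R : realType) (n l : nat) : R :=
  \sum_(m < l) (n - m)%:R^-1.

(** The mean of the best matching of [k] rows into [n] columns, for entries of
    mean 1. *)
Definition mean_cost (R : realType) (n k : nat) : R :=
  \sum_(l < k) l.+1%:R^-1 * partial_harmonic R n l.+1.

Lemma mean_cost_incr (R : realType) (n k : nat) :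
  k%:R * (mean_cost R n k - mean_cost R n k.-1) = partial_harmonic R n k.
Proof.
case: k => [|k]; first by rewrite mul0r /partial_harmonic big_ord0.
rewrite /mean_cost big_ord_recr/= addrAC subrr add0r mulrA divff ?mul1r//.
Qed.

(** Partial fractions: 1 / (l (n + 1 - l)) equals
    (1 / l + 1 / (n + 1 - l)) / (n + 1). *)
Lemma harmonic_convolution (R : realType) (n : nat) :
  \sum_(l < n) l.+1%:R^-1 * (n - l)%:R^-1 =
  2 * n.+1%:R^-1 * \sum_(l < n) l.+1%:R^-1 :> R.
Proof.
have rev : \sum_(l < n) (n - l)%:R^-1 = \sum_(l < n) l.+1%:R^-1 :> R.
  rewrite (reindex_inj rev_ord_inj)/=; apply: eq_bigr => i _.
  by rewrite subKn.
transitivity (n.+1%:R^-1 * \sum_(l < n) (l.+1%:R^-1 + (n - l)%:R^-1) : R).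
  rewrite mulr_sumr; apply: eq_bigr => l _.
  have -> : n.+1%:R = l.+1%:R + (n - l)%:R :> R.
    by rewrite -natrD addSn subnKC// ltnW.
  have a0 : l.+1%:R != 0 :> R by rewrite pnatr_eq0.
  have b0 : (n - l)%:R != 0 :> R by rewrite pnatr_eq0 -lt0n subn_gt0.
  have ab0 : l.+1%:R + (n - l)%:R != 0 :> R by rewrite -natrD pnatr_eq0.
  move: a0 b0 ab0; move: (l.+1%:R : R) ((n - l)%:R : R) => a b a0 b0 ab0.
  by field; rewrite a0 b0 ab0.
by rewrite big_split/= rev; ring.
Qed.

(** The left-hand side is the sum of 1 / (k l) over 1 <= k, l <= n with k + l > n.
    From n to n + 1 the points of the antidiagonal k + l = n + 1 are lost, and
    those of the new row and of the new column are gained; by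
    [harmonic_convolution] only the corner 1 / (n + 1)^2 is left. *)
Lemma mean_cost_diag (R : realType) (n : nat) :
  mean_cost R n n = inv_sqr_sum R n.
Proof.
elim: n => [|n IH]; first by rewrite /mean_cost /inv_sqr_sum !big_ord0.
have shift l : partial_harmonic R n.+1 l.+1 = n.+1%:R^-1 + partial_harmonic R n l.
  by rewrite /partial_harmonic big_ord_recl/= subn0.
rewrite [RHS]big_ord_recr/= -/(inv_sqr_sum R n) -IH /mean_cost big_ord_recr/=.
have H : partial_harmonic R n.+1 n.+1 = \sum_(l < n.+1) l.+1%:R^-1.
  rewrite /partial_harmonic (reindex_inj rev_ord_inj)/=; apply: eq_bigr => i _.
  by rewrite subKn.
rewrite H big_ord_recr/=.
have -> : \sum_(l < n) l.+1%:R^-1 * partial_harmonic R n.+1 l.+1 =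
   \sum_(l < n) l.+1%:R^-1 * partial_harmonic R n l.+1 +
   n.+1%:R^-1 * \sum_(l < n) l.+1%:R^-1 -
   \sum_(l < n) l.+1%:R^-1 * (n - l)%:R^-1.
  rewrite mulr_sumr -big_split/= -sumrB; apply: eq_bigr => l _.
  by rewrite shift /partial_harmonic big_ord_recr/=; ring.
rewrite harmonic_convolution.
by rewrite expr2 invfM; ring.
Qed.

Section Recursion.
Context d (T : measurableType d) (R : realType) (P : probability T R).
Variables (I J : finType) (c : I -> J -> {RV P >-> R}) (r : R).
Hypotheses (r0 : 0 < r)
  (c_exp : forall i j (B : set R), measurable B ->
     distribution P (c i j) B = exponential_prob r B)
  (indep : mutually_independent (fun ij : I * J => c ij.1 ij.2)).

Lemma expected_cost0 : expected_cost c finset.set0 = 0.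
Proof.
rewrite /expected_cost (_ : (fun w => _) = fun=> 0) ?Rintegral_cst ?mul0r//.
apply/funext => w.
have [|f /is_matchingP[h _ _] ->] :=
  @min_cost_attained _ _ _ (fun i j => c i j w) finset.set0 [set: J]%SET.
  by rewrite cards0.
rewrite /cost big1// => i _.
by have := h i; rewrite inE => /negbFE/eqP ->.
Qed.

(** Write B as j |: A.  In [sum_expected_increment] all the means but that of [B]
    concern smaller sets, and are known. *)
Lemma expected_costE (B : {set I}) : (#|B| <= #|J|)%N ->
  expected_cost c B = r^-1 * mean_cost R #|J| #|B|.
Proof.
have [k] := ubnP #|B|; elim: k B => // k IH B; rewrite ltnS => Bk BJ.
have [->|[j jB]] := finset.set_0Vmem B.
  by rewrite cards0 expected_cost0 /mean_cost big_ord0 mulr0.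
pose A := (B :\ j)%SET.
have BE : (j |: A)%SET = B by rewrite finset.setD1K.
have cB : #|B| = #|A|.+1 by rewrite (cardsD1 j) jB.
have jA : j \notin A by rewrite !inE eqxx.
have AJ : (#|A| < #|J|)%N by rewrite -cB.
have Ak : (#|A| < k)%N by rewrite -cB.
have EA : expected_cost c A = r^-1 * mean_cost R #|J| #|A| by apply: IH; rewrite // ltnW.
have EBi i : i \in B -> expected_cost c (B :\ i)%SET = r^-1 * mean_cost R #|J| #|A|.
  move=> iB; have cBi : #|(B :\ i)%SET| = #|A|.
    by move: cB; rewrite (cardsD1 i) iB => -[].
  by rewrite IH cBi// ltnW.
(* For an empty A the predecessor is truncated, but there is no row i. *)
have EAi i : i \in A -> expected_cost c (A :\ i)%SET = r^-1 * mean_cost R #|J| #|A|.-1.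
  move=> iA; have cAi : #|(A :\ i)%SET| = #|A|.-1 by rewrite [in RHS](cardsD1 i) iA.
  have le1 := leq_pred #|A|.
  by rewrite IH cAi//; [exact: leq_ltn_trans Ak|exact: leq_trans (ltnW AJ)].
have := sum_expected_increment r0 c_exp indep jA AJ.
rewrite BE sumrB.
rewrite (eq_bigr (fun=> expected_cost c B - r^-1 * mean_cost R #|J| #|A|)); last first.
  by move=> i /EBi ->.
rewrite sumr_const cB -[X in \sum_(i in pred_of_set X) _]BE big_setU1//=.
have -> : (A :\ j)%SET = A.
  by apply/finset.setP => i; rewrite !inE; case: (i == j).
rewrite subrr add0r (eq_bigr (fun=> r^-1 * (mean_cost R #|J| #|A| -
    mean_cost R #|J| #|A|.-1))); last by move=> i /EAi ->; rewrite EA mulrBr.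
rewrite sumr_const -[X in _ * (X - _)]mulr_natl -[X in _ * (_ - X)]mulr_natl.
rewrite [X in _ * (_ - X)]mulrCA mean_cost_incr.
rewrite /mean_cost big_ord_recr/= -/(mean_cost R #|J| #|A|).
rewrite {2}/partial_harmonic big_ord_recr/= -/(partial_harmonic R #|J| #|A|).
set V := mean_cost _ _ _; set h := partial_harmonic _ _ _; set x := expected_cost c B.
have n0 : (#|J| - #|A|)%:R != 0 :> R by rewrite pnatr_eq0 -lt0n subn_gt0.
have k0 : #|A|.+1%:R != 0 :> R by rewrite pnatr_eq0.
have r0' : r != 0 by rewrite gt_eqF.
move: n0 k0; set N := (_ - _)%:R; set K := (_.+1)%:R => N0 K0; clearbody N K => e.
apply: (mulfI (mulf_neq0 (mulf_neq0 r0' N0) K0)).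
transitivity (1 + r * N * (K * (r^-1 * V) + r^-1 * h)); first by rewrite -e; ring.
by field; rewrite N0 K0 r0'.
Qed.

End Recursion.

Lemma min_assignment_costE (R : realType) n (x : 'I_n -> 'I_n -> R) :
  min_assignment_cost x = n%:R^-1 * min_cost x [set: 'I_n]%SET [set: 'I_n]%SET.
Proof.
have n0 : 0 <= n%:R^-1 :> R by rewrite invr_ge0.
have perm_le (s : 'S_n) :
    n%:R^-1 * min_cost x [set: 'I_n]%SET [set: 'I_n]%SET <= assignment_cost x s.
  rewrite /assignment_cost ler_wpM2l//.
  have ms : is_matching [set: 'I_n]%SET [set: 'I_n]%SET [ffun i => Some (s i)].
    apply/is_matchingP; split => [i|i k|i b]; rewrite !ffunE ?inE//.
    by move=> [/perm_inj].
  apply: le_trans (min_cost_le x ms) _.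
  by rewrite /cost ler_sum// => i _; rewrite ffunE.
apply/eqP; rewrite eq_le; apply/andP; split; last exact: le_bigmin.
have [f /is_matchingP[h1 h2 _] ->] := min_cost_attained x (leqnn #|[set: 'I_n]%SET|).
have fS i : exists b, f i == Some b.
  by have := h1 i; rewrite inE; case: (f i) => // b _; exists b.
pose g i := xchoose (fS i).
have gE i : f i = Some (g i) by apply/eqP; exact: (xchooseP (fS i)).
have g_inj : injective g by move=> i k e; apply: h2; rewrite gE ?e -?gE// gE.
have -> : n%:R^-1 * cost x f = assignment_cost x (perm g_inj).
  rewrite /assignment_cost /cost; congr (_ * _); apply: eq_bigr => i _.
  by rewrite permE gE.
exact: bigmin_le.
Qed.

Lemma expected_assignment_cost (R : realType) n d (T : measurableType d)
    (P : probability T R) (c : 'I_n -> 'I_n -> {RV P >-> R}) : (0 < n)%N ->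
  (forall i j : 'I_n, exponential_with_mean n%:R (c i j)) ->
  mutually_independent (fun ij : 'I_n * 'I_n => c ij.1 ij.2) ->
  ('E_P[fun w => min_assignment_cost (fun i j => c i j w)] =
   (inv_sqr_sum R n)%:E)%E.
Proof.
move=> n0 c_exp indep.
have r0 : 0 < n%:R^-1 :> R by rewrite invr_gt0 ltr0n.
have := expected_costE r0 c_exp indep (B := [set: 'I_n]%SET).
rewrite !cardsT !card_ord leqnn invrK => /(_ isT) e.
rewrite unlock.
under eq_integral do rewrite min_assignment_costE.
have int := integrable_min_cost r0 c_exp indep [set: 'I_n]%SET [set: 'I_n]%SET.
under eq_integral do rewrite EFinM.
rewrite integralZl//.
rewrite -(@fineK _ (\int[P]_x _)%E) ?integrable_fin_num//.
rewrite -EFinM -mean_cost_diag; congr (_%:E).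
move: e; rewrite /expected_cost /Rintegral => ->.
by rewrite mulrA mulVf ?mul1r// pnatr_eq0 -lt0n.
Qed.

Theorem theorem1 (R : realType) (d : nat -> measure_display)
    (T : forall n : nat, measurableType (d n))
    (P : forall n : nat, probability (T n) R)
    (c : forall n : nat, 'I_n -> 'I_n -> {RV (P n) >-> R})
    (c_exp : forall n : nat, (1 <= n)%N ->
      forall i j : 'I_n, exponential_with_mean n%:R (c n i j))
    (c_indep : forall n : nat, (1 <= n)%N ->
      mutually_independent (fun ij : 'I_n * 'I_n => c n ij.1 ij.2)) :
  ('E_(P n)[fun w : T n => min_assignment_cost (fun i j => c n i j w)])%E
    @[n --> \oo] --> (pi ^+ 2 / 6%:R : R)%:E.
Proof.
have basel_ereal : (inv_sqr_sum R n)%:E @[n --> \oo] --> (pi ^+ 2 / 6%:R : R)%:E.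
  by apply: cvg_EFin; [exact: nearW|exact: basel].
apply: cvg_trans basel_ereal; apply: near_eq_cvg; near=> n.
have n0 : (0 < n)%N by near: n; exists 1%N.
by rewrite (expected_assignment_cost n0 (c_exp n n0) (c_indep n n0)).
Unshelve. all: by end_near.
Qed.
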